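(* Let $(M,\tilde\varphi,\xi,\eta,\tilde g)$ be a positive definite or negative definite paracontact metric $(\tilde\kappa,\tilde\mu)$-manifold with $\tilde\kappa>-1$. Then $M$ carries a canonical contact Riemannian structure $(\phi,\xi,\eta,g)$ given by $$\phi:=\mp\frac{1}{\sqrt{1+\tilde\kappa}}\tilde\varphi\tilde h,\qquad g:=-d\eta(\cdot,\phi\,\cdot)+\eta\otimes\eta,$$ where the upper sign is taken in the positive definite case and the lower sign in the negative definite case. Moreover, if $\tilde\mu=2$ then $(\phi,\xi,\eta,g)$ is Sasakian, whereas if $\tilde\mu\neq2$ then $(\phi,\xi,\eta,g)$ is a non-Sasakian contact metric $(\kappa,\mu)$-structure with $$\kappa=1-\Bigl(1-\frac{\tilde\mu}{2}\Bigr)^2,\qquad \mu=2\bigl(1\mp\sqrt{1+\tilde\kappa}\bigr),$$ the sign $\mp$ being $-$ in the positive definite case and $+$ in the negative definite case.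
   Context: Conventions: $2d\eta(X,Y)=X(\eta(Y))-Y(\eta(X))-\eta([X,Y])$; $R_{XY}Z=\nabla_X\nabla_YZ-\nabla_Y\nabla_XZ-\nabla_{[X,Y]}Z$. An almost paracontact structure on a $(2n+1)$-dimensional manifold $M$ is $(\tilde\varphi,\xi,\eta)$, with $\tilde\varphi$ a $(1,1)$-tensor field, $\xi$ a vector field, $\eta$ a 1-form, such that $\eta(\xi)=1$, $\tilde\varphi^2=I-\eta\otimes\xi$ and the $\pm1$-eigendistributions $\mathcal D^\pm$ of $\tilde\varphi$ on $\mathcal D=\ker\eta$ both have dimension $n$. With a pseudo-Riemannian metric $\tilde g$ satisfying $\tilde g(\tilde\varphi X,\tilde\varphi Y)=-\tilde g(X,Y)+\eta(X)\eta(Y)$ and $d\eta(X,Y)=\tilde g(X,\tilde\varphi Y)$ it is a paracontact metric structure. Put $\tilde h=\frac12\mathcal L_\xi\tilde\varphi$. A paracontact metric $(\tilde\kappa,\tilde\mu)$-manifold ($\tilde\kappa,\tilde\mu$ real constants) is a paracontact metric manifold whose curvature tensor satisfies $\tilde R_{XY}\xi=\tilde\kappa(\eta(Y)X-\eta(X)Y)+\tilde\mu(\eta(Y)\tilde hX-\eta(X)\tilde hY)$ for all vector fields $X,Y$. If $\tilde\kappa\neq-1$, the distributions $\mathcal D^\pm$ are integrable (Legendre foliations). The Pang invariant of a Legendre foliation $L$ is the symmetric bilinear form $\Pi_L(X,X')=2d\eta([\xi,X],X')$ on $L$. For $\tilde\kappa>-1$ the paracontact $(\tilde\kappa,\tilde\mu)$-manifold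 is positive (negative) definite if both $\Pi_{\mathcal D^+}$ and $\Pi_{\mathcal D^-}$ are positive (negative) definite. A contact Riemannian (contact metric) structure $(\varphi,\xi,\eta,g)$ consists of a contact form $\eta$ with Reeb field $\xi$, a $(1,1)$-tensor field $\varphi$ and a Riemannian metric $g$ with $\varphi^2=-I+\eta\otimes\xi$, $\varphi\xi=0$, $\eta=g(\cdot,\xi)$, $g(\varphi X,\varphi Y)=g(X,Y)-\eta(X)\eta(Y)$, $g(X,\varphi Y)=d\eta(X,Y)$. With $h=\frac12\mathcal L_\xi\varphi$, it is a contact metric $(\kappa,\mu)$-structure if $R_{XY}\xi=\kappa(\eta(Y)X-\eta(X)Y)+\mu(\eta(Y)hX-\eta(X)hY)$ for all $X,Y$; it is Sasakian iff $R_{XY}\xi=\eta(Y)X-\eta(X)Y$. *)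

(* Defs.v *)
From HB Require Import structures.
From mathcomp Require Import all_boot all_order all_algebra all_fingroup.
From mathcomp Require Import boolp classical_sets functions cardinality.
From mathcomp Require Import reals topology normedtype derive.
From mathcomp Require Import ring.
Import Order.TTheory GRing.Theory Num.Theory.
Import numFieldNormedType.Exports.

Set Implicit Arguments.
Unset Strict Implicit.
Unset Printing Implicit Defensive.

Local Open Scope classical_set_scope.
Local Open Scope ring_scope.

Section SmoothOn.
Context {R : realType} {m : nat}.
Implicit Types (O : set 'rV[R]_m) (f g : 'rV[R]_m -> R).

Definition basis_vec (i : 'I_m) : 'rV[R]_m := delta_mx 0 i.

(* All iterated partial derivatives up to order k exist and are continuous
   on O; only meaningful when O is open. *)
Fixpoint Ck_on (k : nat) O f : Prop :=
  (forall x, O x -> {for x, continuous f}) /\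
  if k is k'.+1 then
    forall i : 'I_m, (forall x, O x -> derivable f x (basis_vec i)) /\
                     Ck_on k' O (fun x => 'D_(basis_vec i) f x)
  else True.

Definition smooth_on O f : Prop := forall k, Ck_on k O f.

Lemma Ck_on_eq k O f g : open O -> (forall x, O x -> f x = g x) ->
  Ck_on k O f -> Ck_on k O g.
Proof.
move=> oO; elim: k f g => [|k IH] f g fg [cf df].
all: have nfg x : O x -> {near x, f =1 g}
  by (move=> Ox; apply: filterS (open_nbhs_nbhs (conj oO Ox)) => y; exact: fg).
all: have cg x : O x -> {for x, continuous g}
  by (move=> Ox; rewrite /prop_for /continuous_at -(fg _ Ox);
      apply: cvg_trans (cf _ Ox); exact: near_eq_cvg (nfg _ Ox)).
  by [].
split=> // i; have [di ci] := df i; split.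
  by move=> x Ox; apply: near_eq_derivable (di _ Ox); exact: nfg.
apply: IH ci => x Ox; apply: near_eq_derive; exact: nfg.
Qed.

Lemma Ck_onW k O f : Ck_on k.+1 O f -> Ck_on k O f.
Proof.
elim: k f => [|k IH] f; first by case.
case=> cf df; split=> // i; have [di ci] := df i; split=> //.
exact: IH ci.
Qed.

Lemma Ck_on_cst k O (c : R) : Ck_on k O (cst c).
Proof.
elim: k c => [|k IH] c /=; split => //.
1,2: by move=> x _; exact: cst_continuous.
move=> i; split; first by move=> x _; exact: derivable_cst.
rewrite (_ : (fun x => _) = cst 0); first exact: IH.
by apply/funext => x; rewrite derive_cst.
Qed.

Lemma Ck_onD k O f g : open O -> Ck_on k O f -> Ck_on k O g ->
  Ck_on k O (f \+ g).
Proof.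
move=> oO; elim: k f g => [|k IH] f g /= [cf df] [cg dg]; split => //.
1,2: by move=> x Ox; apply: continuousD; [exact: cf | exact: cg].
move=> i; have [dfi cfi] := df i; have [dgi cgi] := dg i; split.
  by move=> x Ox; apply: derivableD; [exact: dfi | exact: dgi].
apply: Ck_on_eq (IH _ _ cfi cgi) => // x Ox /=.
by rewrite -deriveD; [| exact: dfi | exact: dgi].
Qed.

Lemma Ck_onM k O f g : open O -> Ck_on k O f -> Ck_on k O g ->
  Ck_on k O (f \* g).
Proof.
move=> oO; elim: k f g => [|k IH] f g Cf Cg; have := Cf; have := Cg;
  case=> cg dg; case=> cf df; split => //.
1,2: by move=> x Ox; apply: continuousM; [exact: cf | exact: cg].
move=> i; have [dfi cfi] := df i; have [dgi cgi] := dg i; split.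
  by move=> x Ox; apply: derivableM; [exact: dfi | exact: dgi].
apply: Ck_on_eq (Ck_onD oO (IH _ _ (Ck_onW Cf) cgi) (IH _ _ (Ck_onW Cg) cfi)).
  exact: oO.
move=> x Ox /=.
by have := deriveM (dfi x Ox) (dgi x Ox); rewrite /GRing.scale /= => <-.
Qed.

End SmoothOn.

Record chart (R : realType) (m : nat) (T : topologicalType) := Chart {
  chart_dom : set T ;
  chart_cod : set 'rV[R]_m ;
  coord : T -> 'rV[R]_m ;
  param : 'rV[R]_m -> T ;
  _ : open chart_dom ;
  chart_cod_open : open chart_cod ;
  _ : forall p, chart_dom p -> chart_cod (coord p) ;
  _ : forall x, chart_cod x -> chart_dom (param x) ;
  _ : forall p, chart_dom p -> param (coord p) = p ;
  _ : forall x, chart_cod x -> coord (param x) = x ;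
  _ : forall p, chart_dom p -> {for p, continuous coord} ;
  _ : forall x, chart_cod x -> {for x, continuous param} }.

Arguments chart_cod_open {R m T} c.

(* Nonempty, Hausdorff, second countable; not assumed connected.  The atlas
   need not be maximal. *)
Record manifold (R : realType) (m : nat) := Manifold {
  carrier :> topologicalType ;
  atlas : set (chart R m carrier) ;
  _ : [set: carrier] !=set0 ;
  _ : hausdorff_space carrier ;
  _ : @second_countable carrier ;
  _ : forall p, exists2 c, atlas c & chart_dom c p ;
  _ : forall c d, atlas c -> atlas d -> forall i : 'I_m,
        smooth_on (chart_cod c `&` param c @^-1` chart_dom d)
                  (fun x => coord d (param c x) 0 i) }.

Section SmoothFunctions.
Context {R : realType} {m : nat} (M : manifold R m).

Definition smooth (f : M -> R) : Prop :=
  forall c, atlas c -> smooth_on (chart_cod c) (f \o param c).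

Definition smooth_pred : {pred M -> R} := [pred f | `[< smooth f >]].

Record smoothFun := SmoothFun {
  smoothFun_val :> M -> R ;
  _ : smoothFun_val \in smooth_pred }.

HB.instance Definition _ := [isSub for smoothFun_val].
HB.instance Definition _ := [Choice of smoothFun by <:].

Lemma smooth_cst (c : R) : cst c \in smooth_pred.
Proof. by apply/asboolP => ch _ k; exact: Ck_on_cst. Qed.

Lemma smooth_subring_closed : subring_closed smooth_pred.
Proof.
have mulP f g : f \in smooth_pred -> g \in smooth_pred -> f * g \in smooth_pred.
  move=> /asboolP sf /asboolP sg; apply/asboolP => c ac k.
  exact: Ck_onM (chart_cod_open c) (sf c ac k) (sg c ac k).
split; [exact: (smooth_cst 1) | | exact: mulP].
move=> f g sf sg; have /asboolP sNg := mulP _ _ (smooth_cst (-1)) sg.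
move/asboolP: sf => sf; apply/asboolP => c ac k.
have := Ck_onD (chart_cod_open c) (sf c ac k) (sNg c ac k).
rewrite (_ : _ \+ _ = (f - g) \o param c) //.
by apply/funext => x /=; rewrite /GRing.mul /= mulN1r.
Qed.

HB.instance Definition _ :=
  GRing.isSubringClosed.Build (M -> R) smooth_pred smooth_subring_closed.
HB.instance Definition _ := GRing.SubChoice_isSubComPzRing.Build (M -> R) smooth_pred
  smoothFun (GRing.subringClosedP _).

Definition constS (c : R) : smoothFun := SmoothFun (smooth_cst c).

End SmoothFunctions.

Section VectorFields.
Context {R : realType} {m : nat} (M : manifold R m).
Local Notation C := (smoothFun M).

(* Vector fields are the R-linear derivations of the ring of smooth
   functions, and tensor fields are maps on vector fields that are
   (multi)linear over that ring. *)
Definition derivation (D : C -> C^o) : Prop :=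
  (forall (c : R) f g, D (constS M c * f + g) = constS M c * D f + D g) /\
  (forall f g, D (f * g) = f * D g + g * D f).

Definition derivation_pred : {pred C -> C^o} := [pred D | `[< derivation D >]].

Record vectorField := VectorField {
  vectorField_val :> C -> C^o ;
  _ : vectorField_val \in derivation_pred }.

HB.instance Definition _ := [isSub for vectorField_val].
HB.instance Definition _ := [Choice of vectorField by <:].

Lemma derivation_submod_closed : submod_closed derivation_pred.
Proof.
split.
  apply/asboolP; split=> [c f g|f g] /=.
    by rewrite mulr0 addr0.
  by rewrite !mulr0 addr0.
move=> h D E /asboolP[D1 D2] /asboolP[E1 E2]; apply/asboolP; split=> [c f g|f g].
  change (h * D (constS M c * f + g) + E (constS M c * f + g) =
    constS M c * (h * D f + E f) + (h * D g + E g)).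
  by rewrite D1 E1 !mulrDr mulrCA addrACA.
change (h * D (f * g) + E (f * g) = f * (h * D g + E g) + g * (h * D f + E f)).
by rewrite D2 E2 !mulrDr addrACA mulrCA [h * (g * _)]mulrCA.
Qed.

HB.instance Definition _ :=
  GRing.isSubmodClosed.Build C (C -> C^o) derivation_pred
    derivation_submod_closed.
HB.instance Definition _ := [SubChoice_isSubLmodule of vectorField by <:].

Lemma lie_derivation (X Y : vectorField) :
  (fun f => X (Y f) - Y (X f)) \in derivation_pred.
Proof.
case: X Y => [X /= /asboolP[X1 X2]] [Y /= /asboolP[Y1 Y2]].
have XD (f g : C) : X (f + g) = X f + X g.
  by have := X1 1 f g; rewrite (_ : constS M 1 = 1) ?mul1r //; exact: val_inj.
have YD (f g : C) : Y (f + g) = Y f + Y g.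
  by have := Y1 1 f g; rewrite (_ : constS M 1 = 1) ?mul1r //; exact: val_inj.
apply/asboolP; split=> [c f g|f g].
  by rewrite Y1 X1 X1 Y1 mulrBr opprD addrACA.
rewrite Y2 X2 XD YD !X2 !Y2.
ring.
Qed.

Definition lie (X Y : vectorField) : vectorField :=
  VectorField (lie_derivation X Y).

End VectorFields.

Section Geometry.
Context {R : realType} {m : nat} {M : manifold R m}.
Local Notation C := (smoothFun M).
Local Notation VF := (vectorField M).
Implicit Types (phi : VF -> VF) (xi : VF) (eta : VF -> C) (g : VF -> VF -> C).

(* Value of a vector field at a point, as a tangent vector, i.e. as a
   functional on smooth functions. *)
Definition vf_at (X : VF) (p : M) : C -> R^o := fun f => X f p.

Definition endo_tensor phi : Prop :=
  forall (f : C) (X Y : VF), phi (f *: X + Y) = f *: phi X + phi Y.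

Definition one_form eta : Prop :=
  forall (f : C) (X Y : VF), eta (f *: X + Y) = f * eta X + eta Y.

Definition sym_bilinear g : Prop :=
  (forall X, one_form (g X)) /\ (forall X Y, g X Y = g Y X).

Definition pseudo_riemannian g : Prop :=
  sym_bilinear g /\
  forall (p : M) (X : VF), (forall Y, g X Y p = 0) -> vf_at X p = 0.

Definition riemannian g : Prop :=
  sym_bilinear g /\ forall (p : M) (X : VF), vf_at X p != 0 -> 0 < g X X p.

(* Convention: 2 d eta (X, Y) = X (eta Y) - Y (eta X) - eta [X, Y]. *)
Definition ext_d eta (X Y : VF) : C :=
  constS M 2^-1 * (X (eta Y) - Y (eta X) - eta (lie X Y)).

Definition lie_endo xi phi (X : VF) : VF := lie xi (phi X) - phi (lie xi X).

Definition h_tensor xi phi (X : VF) : VF := constS M 2^-1 *: lie_endo xi phi X.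

Definition connection (nabla : VF -> VF -> VF) : Prop :=
  [/\ forall (f : C) X X' Y, nabla (f *: X + X') Y = f *: nabla X Y + nabla X' Y,
      forall X Y Z, nabla X (Y + Z) = nabla X Y + nabla X Z &
      forall (f : C) X Y, nabla X (f *: Y) = X f *: Y + f *: nabla X Y].

Definition levi_civita g (nabla : VF -> VF -> VF) : Prop :=
  [/\ connection nabla,
      forall X Y, nabla X Y - nabla Y X = lie X Y &
      forall (X Y Z : VF), X (g Y Z) = g (nabla X Y) Z + g Y (nabla X Z)].

Definition curvature (nabla : VF -> VF -> VF) (X Y Z : VF) : VF :=
  nabla X (nabla Y Z) - nabla Y (nabla X Z) - nabla (lie X Y) Z.

(* The Levi-Civita connection is unique; asking for one that satisfies the
   curvature identity includes its existence. *)
Definition kappa_mu_condition phi xi eta g (k mu : R) : Prop :=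
  exists2 nabla, levi_civita g nabla &
    forall X Y, curvature nabla X Y xi =
      constS M k *: (eta Y *: X - eta X *: Y) +
      constS M mu *: (eta Y *: h_tensor xi phi X - eta X *: h_tensor xi phi Y).

(* A distribution is given by its set L of sections; its fibre at p is the
   set of values at p of these sections. *)
Definition rank_at (L : set VF) (p : M) (r : nat) : Prop :=
  exists e : 'I_r -> VF,
    [/\ forall i, L (e i),
        forall c : 'I_r -> R, \sum_i c i *: vf_at (e i) p = 0 ->
          forall i, c i = 0 &
        forall X, L X -> exists c : 'I_r -> R,
          vf_at X p = \sum_i c i *: vf_at (e i) p].

Definition eigen_dist_plus phi eta : set VF :=
  [set X | eta X = 0 /\ phi X = X].

Definition eigen_dist_minus phi eta : set VF :=
  [set X | eta X = 0 /\ phi X = - X].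

Definition pang_invariant xi eta (X X' : VF) : C :=
  constS M 2 * ext_d eta (lie xi X) X'.

Definition positive_on (L : set VF) (b : VF -> VF -> C) : Prop :=
  forall (p : M) X, L X -> vf_at X p != 0 -> 0 < b X X p.

Definition negative_on (L : set VF) (b : VF -> VF -> C) : Prop :=
  forall (p : M) X, L X -> vf_at X p != 0 -> b X X p < 0.

Definition pang_positive_definite phi xi eta : Prop :=
  positive_on (eigen_dist_plus phi eta) (pang_invariant xi eta) /\
  positive_on (eigen_dist_minus phi eta) (pang_invariant xi eta).

Definition pang_negative_definite phi xi eta : Prop :=
  negative_on (eigen_dist_plus phi eta) (pang_invariant xi eta) /\
  negative_on (eigen_dist_minus phi eta) (pang_invariant xi eta).

End Geometry.

Section Structures.
Context {R : realType} {n : nat} {M : manifold R n.*2.+1}.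
Local Notation C := (smoothFun M).
Local Notation VF := (vectorField M).
Implicit Types (phi : VF -> VF) (xi : VF) (eta : VF -> C) (g : VF -> VF -> C).

Definition almost_paracontact phi xi eta : Prop :=
  [/\ endo_tensor phi, one_form eta, eta xi = 1,
      forall X, phi (phi X) = X - eta X *: xi &
      forall p : M, rank_at (eigen_dist_plus phi eta) p n /\
                    rank_at (eigen_dist_minus phi eta) p n].

Definition paracontact_metric phi xi eta g : Prop :=
  [/\ almost_paracontact phi xi eta, pseudo_riemannian g,
      forall X Y, g (phi X) (phi Y) = - g X Y + eta X * eta Y &
      forall X Y, ext_d eta X Y = g X (phi Y)].

Definition paracontact_kappa_mu phi xi eta g (k mu : R) : Prop :=
  paracontact_metric phi xi eta g /\ kappa_mu_condition phi xi eta g k mu.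

(* eta /\ (d eta)^n evaluated on 2n+1 vector fields, the wedge product being
   the alternation of the tensor product (normalisation matching ext_d). *)
Definition eta_wedge_deta eta (X : 'I_n.*2.+1 -> VF) : C :=
  constS M (n.*2.+1`!%:R^-1) *
  \sum_(s : 'S_n.*2.+1) (-1) ^+ s *
    (eta (X (s ord0)) *
     \prod_(i < n) ext_d eta (X (s (inord i.*2.+1))) (X (s (inord i.*2.+2)))).

Definition contact_form eta : Prop :=
  one_form eta /\
  forall p : M, exists X : 'I_n.*2.+1 -> VF, eta_wedge_deta eta X p != 0.

Definition reeb_field eta xi : Prop :=
  eta xi = 1 /\ forall X, ext_d eta xi X = 0.

Definition contact_metric phi xi eta g : Prop :=
  [/\ contact_form eta, reeb_field eta xi, endo_tensor phi & riemannian g] /\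
  [/\ forall X, phi (phi X) = - X + eta X *: xi,
      phi xi = 0,
      forall X, eta X = g X xi,
      forall X Y, g (phi X) (phi Y) = g X Y - eta X * eta Y &
      forall X Y, g X (phi Y) = ext_d eta X Y].

Definition contact_kappa_mu phi xi eta g (k mu : R) : Prop :=
  contact_metric phi xi eta g /\ kappa_mu_condition phi xi eta g k mu.

Definition sasakian phi xi eta g : Prop :=
  contact_metric phi xi eta g /\
  exists2 nabla, levi_civita g nabla &
    forall X Y, curvature nabla X Y xi = eta Y *: X - eta X *: Y.

End Structures.

(* Main.v *)
Require Import Defs.
From HB Require Import structures.
From mathcomp Require Import all_boot all_order all_algebra all_fingroup.
From mathcomp Require Import boolp functions reals topology.
From mathcomp Require Import ring lra zify.
Import Order.TTheory GRing.Theory Num.Theory.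

Set Implicit Arguments.
Unset Strict Implicit.
Unset Printing Implicit Defensive.

Local Open Scope ring_scope.

(** For a paracontact metric (k, mu)-structure (phi, xi, eta, g) with
    1 + k > 0, write h for half the Lie derivative of phi along xi, s for the
    square root of 1 + k, and a = 1 / s or a = - 1 / s according to the sign of
    the Pang invariants.

    The Codazzi-type expansion of the curvature R(X, Y) xi (curvature_xi)
    together with the nullity condition determines first h^2 = (1 + k) phi^2
    (h2), and then the covariant derivatives of phi and of h as explicit tensors
    (DphiE, DhE).  The key point is that h exchanges the two eigendistributions
    D+ and D- of phi and is invertible there because 1 + k <> 0: comparing the
    components of the Codazzi identity on D+ and D- makes every component of
    nabla phi and nabla h on ker eta vanish.

    The new metric is a g(., h .) + eta (x) eta.  The Pang invariant of D+ and
    of D- is 2 g(h ., .) (pang_invariant_eig), so the sign of a makes this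
    metric positive definite on both distributions; they are orthogonal for it,
    since h maps each of them into the other and both are isotropic for g.
    As nabla h is known, Koszul's formula for the new metric can be solved in
    closed form: its Levi-Civita connection is nabla plus an explicit symmetric
    tensor (assoc_levi_civita).  A direct expansion then gives, with
    p = mu / 2 - 1, the curvature

      R'(X, Y) xi = (1 - p^2) (eta(Y) X - eta(X) Y)
                    + 2 p (a - 1) (eta(Y) h X - eta(X) h Y)

    (assoc_curvature_xi), while the tensor h' of the new structure is a p h
    (assoc_h).  For mu = 2 this is the Sasakian identity.  Otherwise it is a
    (k', mu')-identity with mu' a = 2 (a - 1), that is mu' = 2 (1 - 1 / a).  It
    is not Sasakian, because the Levi-Civita connection is unique
    (levi_civita_unique) and on D+ the Sasakian identity would force p = 0.

    That eta is a contact form is seen at each point on the frame made of xi, a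
    frame of D+ and the dual frame of D- for d eta: in the alternating sum that
    defines eta /\ (d eta)^n all nonzero terms have the same sign
    (wedge_sum_gt0). *)

(** * Calculus of smooth functions and vector fields *)

(** The limit c -> 0, obtained by adding the inequalities at the two values of
    c for which the quadratic term is - u. *)
Lemma quadratic_ge0 (R : rcfType) (u v w : R) :
  0 < w -> (forall c, c != 0 -> 0 < u + v * c + w * (c * c)) -> 0 <= u.
Proof.
move=> w0 q; rewrite leNgt; apply/negP => u0.
have d0 : 0 < - u / w by rewrite divr_gt0 // oppr_gt0.
pose c := Num.sqrt (- u / w).
have c0 : c != 0 by rewrite sqrtr_eq0 -ltNge.
have cc : w * (c * c) = - u.
  by rewrite -expr2 sqr_sqrtr ?ltW // mulrCA divff ?mulr1 // gt_eqF.
have := q c c0; have := q (- c); rewrite oppr_eq0 mulrNN cc => /(_ c0).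
lra.
Qed.

Section Evaluation.
Context {R : realType} {m : nat} {M : manifold R m}.
Local Notation C := (smoothFun M).
Local Notation VF := (vectorField M).
Local Notation cst := (constS M).
Implicit Types (f u v : C) (X Y Z : VF) (c : R) (p : M).

Lemma smoothFun_ext u v : (forall p, u p = v p) -> u = v.
Proof. by move=> uv; apply/val_inj/funext. Qed.

Lemma ev0 p : (0 : C) p = 0. Proof. by []. Qed.
Lemma ev1 p : (1 : C) p = 1. Proof. by []. Qed.
Lemma evD u v p : (u + v) p = u p + v p. Proof. by []. Qed.
Lemma evN u p : (- u) p = - u p. Proof. by []. Qed.
Lemma evM u v p : (u * v) p = u p * v p. Proof. by []. Qed.
Lemma ev_cst c p : (cst c) p = c. Proof. by []. Qed.
Lemma evMn u k p : (u *+ k) p = u p *+ k.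
Proof. by elim: k => // k ih; rewrite !mulrS evD ih. Qed.

(** Evaluation at a point turns identities between smooth functions into
    identities of real numbers, where linear arithmetic decides them. *)
Definition evE := (evD, evN, evM, ev_cst, ev0, ev1, evMn).

Lemma cst1 : cst 1 = 1. Proof. exact: smoothFun_ext. Qed.
Lemma cst0 : cst 0 = 0. Proof. exact: smoothFun_ext. Qed.
Lemma cstD c d : cst (c + d) = cst c + cst d. Proof. exact: smoothFun_ext. Qed.
Lemma cstN c : cst (- c) = - cst c. Proof. exact: smoothFun_ext. Qed.
Lemma cstM c d : cst (c * d) = cst c * cst d. Proof. exact: smoothFun_ext. Qed.
Definition cstE := (cstD, cstN, cstM, cst1, cst0).
Lemma cst2 : cst 2 = 2. Proof. by rewrite -[2]/(1 + 1) cstD cst1. Qed.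
Lemma cst2V : cst 2^-1 * 2 = 1.
Proof. by rewrite -cst2 -cstM mulVf ?cst1 // pnatr_eq0. Qed.

Lemma two_inj u v : 2 * u = 2 * v -> u = v.
Proof. by move=> e; rewrite -[u]mul1r -[v]mul1r -cst2V -!mulrA e. Qed.

(** The ring of smooth functions has zero divisors but no nilpotents. *)
Lemma sqr_eq0 u : u * u = 0 -> u = 0.
Proof.
move=> u2; apply: smoothFun_ext => p; have := congr1 (fun v : C => v p) u2.
by rewrite !evE => /eqP; rewrite mulf_eq0 orbb => /eqP.
Qed.

Lemma vf_ext X Y : (forall f, X f = Y f) -> X = Y.
Proof. by move=> XY; apply/val_inj/funext. Qed.

Lemma vf_appD X Y f : (X + Y) f = X f + Y f. Proof. by []. Qed.
Lemma vf_appN X f : (- X) f = - X f. Proof. by []. Qed.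
Lemma vf_appZ u X f : (u *: X) f = u * X f. Proof. by []. Qed.
Lemma vf_app0 f : (0 : VF) f = 0. Proof. by []. Qed.
Lemma lieE X Y f : lie X Y f = X (Y f) - Y (X f). Proof. by []. Qed.

(** A vector field is the derivation it defines, so applying both sides to an
    arbitrary function turns a vector identity into a ring identity. *)
Definition appE := (vf_appD, vf_appN, vf_appZ, vf_app0, lieE).

Lemma vf_der X : derivation X.
Proof. by case: X => X /= /asboolP. Qed.
Lemma vfD X f u : X (f + u) = X f + X u.
Proof. by have := (vf_der X).1 1 f u; rewrite cst1 !mul1r. Qed.
Lemma vfM X f u : X (f * u) = f * X u + u * X f.
Proof. exact: (vf_der X).2. Qed.
Lemma vf0 X : X 0 = 0.
Proof. by apply: (addIr (X 0)); rewrite -vfD !add0r. Qed.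
Lemma vfN X f : X (- f) = - X f.
Proof. by apply: (addrI (X f)); rewrite -vfD !subrr vf0. Qed.
Lemma vf_cst X c : X (cst c) = 0.
Proof.
have e1 : X 1 = 0.
  by apply: (addIr (X 1)); rewrite add0r -[in RHS](mulr1 1) vfM !mul1r.
by have := (vf_der X).1 c 1 0; rewrite vf0 e1 mulr1 mulr0 !addr0.
Qed.
Lemma vf1 X : X 1 = 0. Proof. by rewrite -cst1 vf_cst. Qed.
Definition derE := (vfD, vfM, vfN, vf0, vf1, vf_cst).

End Evaluation.

(** Decides identities of vector fields that hold in every module over the
    ring of smooth functions, given the derivation rules. *)
Ltac vring := apply: vf_ext => ?; rewrite ?(appE, derE); ring.

Section VectorFieldCalculus.
Context {R : realType} {m : nat} {M : manifold R m}.
Local Notation C := (smoothFun M).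
Local Notation VF := (vectorField M).
Local Notation cst := (constS M).
Implicit Types (f u v : C) (X Y Z : VF) (c : R) (p : M).

Lemma lieDr X Y Z : lie X (Y + Z) = lie X Y + lie X Z. Proof. vring. Qed.
Lemma lieZr X f Y : lie X (f *: Y) = X f *: Y + f *: lie X Y. Proof. vring. Qed.
Lemma lieNr X Y : lie X (- Y) = - lie X Y. Proof. vring. Qed.
Lemma lie_jacobi X Y Z :
  lie (lie X Y) Z + lie (lie Y Z) X + lie (lie Z X) Y = 0.
Proof. vring. Qed.

Lemma vf_at_eq0 X p : (forall f, X f p = 0) -> vf_at X p = 0.
Proof. by move=> X0; apply/funext => f; exact: X0. Qed.

Lemma ev_sum (I : finType) (P : pred I) (u : I -> C) p :
  (\sum_(i | P i) u i) p = \sum_(i | P i) u i p.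
Proof. by apply: (big_morph (fun v : C => v p)). Qed.

Lemma ev_prod (I : finType) (P : pred I) (u : I -> C) p :
  (\prod_(i | P i) u i) p = \prod_(i | P i) u i p.
Proof. by apply: (big_morph (fun v : C => v p)). Qed.

Lemma ev_sign (t : bool) p : ((-1) ^+ t : C) p = (-1) ^+ t.
Proof. by case: t. Qed.

Lemma vf_at_sum (I : finType) (c : I -> R) (X : I -> VF) p :
  vf_at (\sum_i cst (c i) *: X i) p = \sum_i c i *: vf_at (X i) p.
Proof. by apply: (big_morph (fun X => vf_at X p)). Qed.

End VectorFieldCalculus.

(** * The top power of a symplectic form in a Darboux frame *)

Section SymplecticPermutations.
Context (R : realDomainType) (n : nat) (T : finType).
Context (z : T) (o e : 'I_n -> T) (c : T -> R) (A : T -> T -> R).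
(* The indices of the frame are z for the Reeb direction and n symplectic pairs
   (o i, e i); A is the Gram matrix of the two-form and c the one-form. *)
Hypothesis o_inj : injective o.
Hypothesis e_inj : injective e.
Hypothesis oe : forall i j, o i != e j.
Hypothesis oz : forall i, o i != z.
Hypothesis ez : forall i, e i != z.
Hypothesis cover : forall x, [\/ x = z, exists i, x = o i | exists i, x = e i].
Hypothesis cz : forall x, c x = (x == z)%:R.
Hypothesis Asym : forall x y, A x y = - A y x.
Hypothesis Az : forall x, A z x = 0.
Hypothesis Aoo : forall i j, A (o i) (o j) = 0.
Hypothesis Aee : forall i j, A (e i) (e j) = 0.
Hypothesis Aoe : forall i j, A (o i) (e j) = (i == j)%:R.
Implicit Types (s : {perm T}) (i j l : 'I_n) (x y : T).

Definition wedge_term s : R :=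
  (-1) ^+ s * (c (s z) * \prod_i A (s (o i)) (s (e i))).

Let eo i j : e i != o j. Proof. by rewrite eq_sym. Qed.

(** Exchanging the two members of a pair changes the sign of the permutation
    and the sign of one factor. *)
Lemma wedge_term_flip j s :
  wedge_term (tperm (o j) (e j) * s)%g = wedge_term s.
Proof.
rewrite /wedge_term odd_permM odd_tperm oe signr_addb expr1 mulN1r mulNr.
rewrite permM tpermD // -mulrN -mulrN; congr (_ * (_ * _)).
rewrite (bigD1 j) //= [RHS](bigD1 j) //= !permM tpermL tpermR Asym mulNr opprK.
congr (_ * _); apply: eq_bigr => i ij; rewrite !permM.
by rewrite !tpermD // (inj_eq o_inj, inj_eq e_inj) eq_sym.
Qed.

(** Exchanging two pairs is an even permutation that only reorders the
    factors. *)
Lemma wedge_term_swap i j s :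
  wedge_term (tperm (o i) (o j) * tperm (e i) (e j) * s)%g = wedge_term s.
Proof.
rewrite /wedge_term !odd_permM !odd_tperm (inj_eq o_inj) (inj_eq e_inj) addbb.
rewrite !permM ![tperm _ _ z]tpermD //; congr (_ * (_ * _)).
rewrite [RHS](reindex_inj (@perm_inj _ (tperm i j))).
apply: eq_bigr => l _; rewrite !permM.
have oE : tperm (o i) (o j) (o l) = o (tperm i j l).
  by case: tpermP => [/o_inj->|/o_inj->|/eqP + /eqP]; rewrite ?tpermL ?tpermR //
    !(inj_eq o_inj) => li lj; rewrite tpermD // eq_sym.
have eE : tperm (e i) (e j) (e l) = e (tperm i j l).
  by case: tpermP => [/e_inj->|/e_inj->|/eqP + /eqP]; rewrite ?tpermL ?tpermR //
    !(inj_eq e_inj) => li lj; rewrite tpermD // eq_sym.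
by rewrite oE ![tperm (o _) _ (e _)]tpermD // eE [tperm _ _ (o _)]tpermD.
Qed.

Lemma A_neq0 x y : A x y != 0 ->
  exists i, (x = o i /\ y = e i) \/ (x = e i /\ y = o i).
Proof.
case: (cover x) => [->|[i ->]|[i ->]]; first by rewrite Az eqxx.
- case: (cover y) => [->|[j ->]|[j ->]].
  + by rewrite Asym Az oppr0 eqxx.
  + by rewrite Aoo eqxx.
  + rewrite Aoe; case: (eqVneq i j) => [->|_]; rewrite ?eqxx //.
    by exists j; left.
- case: (cover y) => [->|[j ->]|[j ->]].
  + by rewrite Asym Az oppr0 eqxx.
  + rewrite Asym Aoe [j == i]eq_sym.
    case: (eqVneq i j) => [->|_]; rewrite ?oppr0 ?eqxx //.
    by exists j; right.
  + by rewrite Aee eqxx.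
Qed.

Lemma wedge_term_neq0 s : wedge_term s != 0 ->
  s z = z /\ forall i, A (s (o i)) (s (e i)) != 0.
Proof.
rewrite /wedge_term mulf_eq0 signr_eq0 /= mulf_eq0 negb_or cz => /andP[sz].
move/prodf_neq0 => p0; split; last by move=> i; exact: p0.
by apply/eqP; apply: contraNT sz => /negbTE ->; rewrite eqxx.
Qed.

Lemma wedge_term1 : wedge_term 1%g = 1.
Proof.
rewrite /wedge_term odd_perm1 expr0 perm1 cz eqxx !mul1r big1 // => i _.
by rewrite !perm1 Aoe eqxx.
Qed.

(** A permutation with a nonzero term maps z to itself and pairs to pairs, hence
    is a product of flips and swaps, which do not change the term.  The
    induction makes the permutation fix the first k pairs, for increasing k. *)
Lemma wedge_term_01 s : wedge_term s != 0 -> wedge_term s = 1.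
Proof.
suff H d k : (d + k = n)%N -> forall s,
    (forall i, (i < k)%N -> s (o i) = o i /\ s (e i) = e i) ->
    wedge_term s != 0 -> wedge_term s = 1.
  by apply: (H n 0%N); rewrite ?addn0.
elim: d k => [|d ih] k; first rewrite add0n => kn {}s fix_s s0.
  have [sz _] := wedge_term_neq0 s0.
  suff -> : s = 1%g by exact: wedge_term1.
  apply/permP => x; rewrite perm1; case: (cover x) => [->//|[i ->]|[i ->]].
    by case: (fix_s i); rewrite ?kn.
  by case: (fix_s i); rewrite ?kn.
move=> dk; have kn : (k < n)%N by lia.
pose l := Ordinal kn; have dk' : (d + k.+1 = n)%N by lia.
have key s' j : (forall i, (i < k)%N -> s' (o i) = o i /\ s' (e i) = e i) ->
    wedge_term s' != 0 -> s' (o j) = o l -> wedge_term s' = 1.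
  move=> fix_s s0 sj; have [sz /(_ j)/A_neq0[j' jj]] := wedge_term_neq0 s0.
  have sej : s' (e j) = e l.
    case: jj; rewrite sj => -[]; first by move/o_inj <-.
    by move/eqP; rewrite (negbTE (oe _ _)).
  rewrite -(wedge_term_swap l j s'); apply: (ih _ dk'); last first.
    by rewrite wedge_term_swap.
  move=> i; rewrite ltnS leq_eqVlt => /orP[/eqP il|ik].
    have -> : i = l by exact: val_inj.
    by rewrite !permM tpermL ![tperm _ _ (o _)]tpermD // sj
       [tperm _ _ (e l)]tpermD // tpermL sej.
  have li : l != i by apply: contraTneq ik => <-; rewrite ltnn.
  have [oi ei] := fix_s i ik.
  have ji : j != i.
    by apply: contraNneq li => e1; rewrite -(inj_eq o_inj) -sj e1 oi.
  by rewrite !permM !tpermD // ?(inj_eq o_inj) ?(inj_eq e_inj).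
move=> {}s fix_s s0; have [sz sA] := wedge_term_neq0 s0.
have [x sx] : exists x, s x = o l by exists ((s^-1)%g (o l)); rewrite permKV.
case: (cover x) => [xz|[j xj]|[j xj]].
- by move: sx; rewrite xz sz => /esym/eqP; rewrite (negbTE (oz _)).
- by apply: (key s j) => //; rewrite -xj.
rewrite -(wedge_term_flip j); apply: (key _ j).
- move=> i ik; have [oi ei] := fix_s i ik.
  have ji : j != i.
    apply/eqP => ji; move/eqP: ei.
    by rewrite -ji -{1}xj sx (negbTE (oe _ _)).
  by rewrite !permM !tpermD // ?(inj_eq o_inj) ?(inj_eq e_inj).
- by rewrite wedge_term_flip.
- by rewrite permM tpermL -xj.
Qed.

Lemma wedge_sum_gt0 : 0 < \sum_s wedge_term s.
Proof.
rewrite (bigD1 1%g) //= wedge_term1 ltr_wpDr // sumr_ge0 // => s _.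
by have [->//|/wedge_term_01 ->] := eqVneq (wedge_term s) 0.
Qed.

End SymplecticPermutations.

(** The positions of the two arguments of the i-th factor d eta in the product
    eta /\ (d eta)^n. *)
Section Slots.
Context {n : nat}.
Implicit Types (i j : 'I_n).

Definition odd_slot i : 'I_n.*2.+1 := inord i.*2.+1.
Definition even_slot i : 'I_n.*2.+1 := inord i.*2.+2.

Lemma val_odd_slot i : odd_slot i = i.*2.+1 :> nat.
Proof. by rewrite inordK //; have := ltn_ord i; lia. Qed.

Lemma val_even_slot i : even_slot i = i.*2.+2 :> nat.
Proof. by rewrite inordK //; have := ltn_ord i; lia. Qed.

Lemma odd_slot_inj : injective odd_slot.
Proof.
move=> i j /(congr1 val); rewrite /= !val_odd_slot => ij.
by apply: val_inj => /=; lia.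
Qed.

Lemma even_slot_inj : injective even_slot.
Proof.
move=> i j /(congr1 val); rewrite /= !val_even_slot => ij.
by apply: val_inj => /=; lia.
Qed.

Lemma odd_even_slot i j : odd_slot i != even_slot j.
Proof. by rewrite -val_eqE /= val_odd_slot val_even_slot; lia. Qed.

Lemma odd_slot_neq0 i : odd_slot i != ord0.
Proof. by rewrite -val_eqE /= val_odd_slot. Qed.

Lemma even_slot_neq0 i : even_slot i != ord0.
Proof. by rewrite -val_eqE /= val_even_slot. Qed.

Lemma slot_cases (x : 'I_n.*2.+1) :
  [\/ x = ord0, exists i, x = odd_slot i | exists i, x = even_slot i].
Proof.
have [x0|x0] := eqVneq x ord0; first by constructor 1.
have xn := ltn_ord x; rewrite -val_eqE /= in x0.
have x2n : (x.-1./2 < n)%N by lia.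
have [ox|ox] := boolP (odd x).
  constructor 2; exists (Ordinal x2n); apply: val_inj.
  by rewrite /= val_odd_slot /=; lia.
constructor 3; exists (Ordinal x2n); apply: val_inj.
by rewrite /= val_even_slot /=; lia.
Qed.

End Slots.

Lemma manifold_inhabited (R : realType) (m : nat) (M : manifold R m) :
  exists p : M, True.
Proof. by case: M => T A ne *; case: ne => p ?; exists p. Qed.

(** * Tensor fields and covariant derivatives *)

(** Linear arithmetic over the smooth functions: every equation in the context
    and the goal is evaluated at a common point. *)
Ltac pointwise :=
  intros; apply: smoothFun_ext; let p := fresh "p" in intro p;
  repeat match goal with
  | H : @eq _ _ _ |- _ =>
    apply (f_equal (fun f : smoothFun _ => smoothFun_val f p)) in H;
    rewrite ?evE in H
  end; rewrite ?evE; lra.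

(** The same for vector fields, evaluated at a function and a point. *)
Ltac vpointwise :=
  intros; apply: vf_ext; let f := fresh "f" in intro f;
  repeat match goal with
  | H : @eq _ _ _ |- _ =>
    apply (f_equal (fun X : vectorField _ => vectorField_val X f)) in H;
    rewrite ?appE in H
  end; rewrite ?appE; pointwise.

(** The covariant derivative (nabla_X E) Y.  It is locked so that the linearity
    rewrite rules treat it as an atom. *)
HB.lock Definition cov_endo (R : realType) (m : nat) (M : manifold R m)
    (nabla : vectorField M -> vectorField M -> vectorField M)
    (E : vectorField M -> vectorField M) (X Y : vectorField M) :=
  nabla X (E Y) - E (nabla X Y).

Lemma neq_negb (s t : bool) : s != t -> ~~ s = t.
Proof. by case: s t => [] []. Qed.

Section Tensors.
Context {R : realType} {m : nat} {M : manifold R m}.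
Local Notation C := (smoothFun M).
Local Notation VF := (vectorField M).
Implicit Types (f u : C) (X Y Z : VF) (c : R).

Section OneForm.
Context (w : VF -> C) (lw : one_form w).
Lemma one_formD X Y : w (X + Y) = w X + w Y.
Proof. by have := lw 1 X Y; rewrite scale1r mul1r. Qed.
Lemma one_form0 : w 0 = 0.
Proof. by apply: (addIr (w 0)); rewrite -one_formD !add0r. Qed.
Lemma one_formZ f X : w (f *: X) = f * w X.
Proof. by have := lw f X 0; rewrite one_form0 !addr0. Qed.
Lemma one_formN X : w (- X) = - w X.
Proof. by rewrite -scaleN1r one_formZ mulN1r. Qed.
End OneForm.

Lemma form_sum (w : VF -> C) (I : finType) (u : I -> C) (X : I -> VF) :
  one_form w -> w (\sum_i u i *: X i) = \sum_i u i * w (X i).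
Proof.
move=> lw; rewrite (big_morph w (one_formD lw) (one_form0 lw)).
by apply: eq_bigr => i _; rewrite (one_formZ lw).
Qed.

Section Endo.
Context (E : VF -> VF) (lE : endo_tensor E).
Lemma endoD X Y : E (X + Y) = E X + E Y.
Proof. by have := lE 1 X Y; rewrite !scale1r. Qed.
Lemma endo0 : E 0 = 0.
Proof. by apply: (addIr (E 0)); rewrite -endoD !add0r. Qed.
Lemma endoZ f X : E (f *: X) = f *: E X.
Proof. by have := lE f X 0; rewrite endo0 !addr0. Qed.
Lemma endoN X : E (- X) = - E X.
Proof. by rewrite -scaleN1r endoZ scaleN1r. Qed.
End Endo.

(** This is d (d eta) = 0, a consequence of the Jacobi identity. *)
Lemma ext_d_closed eta X Y Z : one_form eta ->
  X (ext_d eta Y Z) + Y (ext_d eta Z X) + Z (ext_d eta X Y) =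
  ext_d eta (lie X Y) Z + ext_d eta (lie Y Z) X + ext_d eta (lie Z X) Y.
Proof.
move=> le.
have e : eta (lie (lie X Y) Z) =
    - eta (lie (lie Y Z) X) - eta (lie (lie Z X) Y).
  have := congr1 eta (lie_jacobi X Y Z).
  rewrite !(one_formD le) (one_form0 le) => J.
  by apply/eqP; rewrite -subr_eq0 -J; apply/eqP; ring.
rewrite /ext_d !derE !lieE; ring: e.
Qed.

Lemma h_tensor_endo (phi : VF -> VF) xi : endo_tensor phi ->
  endo_tensor (h_tensor xi phi).
Proof.
move=> lp f X Y; rewrite /h_tensor /lie_endo.
by rewrite !(endoD lp, endoZ lp, lieDr, lieZr); vring.
Qed.

Section CovEndo.
Context (nabla : VF -> VF -> VF) (E : VF -> VF).
Hypotheses (conn : connection nabla) (lE : endo_tensor E).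

Let conn_l Y : endo_tensor (nabla^~ Y).
Proof. by case: conn => c _ _ f X X'; exact: c. Qed.
Lemma connDl X X' Y : nabla (X + X') Y = nabla X Y + nabla X' Y.
Proof. exact: endoD (conn_l Y) _ _. Qed.
Lemma connZl f X Y : nabla (f *: X) Y = f *: nabla X Y.
Proof. exact: endoZ (conn_l Y) _ _. Qed.
Lemma connNl X Y : nabla (- X) Y = - nabla X Y.
Proof. exact: endoN (conn_l Y) _. Qed.
Lemma connDr X Y Z : nabla X (Y + Z) = nabla X Y + nabla X Z.
Proof. by case: conn. Qed.
Lemma connZr f X Y : nabla X (f *: Y) = X f *: Y + f *: nabla X Y.
Proof. by case: conn. Qed.
Lemma conn0r X : nabla X 0 = 0.
Proof. by apply: (addIr (nabla X 0)); rewrite -connDr !add0r. Qed.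
Lemma connNr X Y : nabla X (- Y) = - nabla X Y.
Proof. by apply: (addrI (nabla X Y)); rewrite -connDr !subrr conn0r. Qed.

Lemma cov_endo_l Y : endo_tensor (fun X => cov_endo nabla E X Y).
Proof.
move=> f X X'.
by rewrite !cov_endo.unlock !(connDl, connZl, endoD lE, endoZ lE); vring.
Qed.

Lemma cov_endo_r X : endo_tensor (cov_endo nabla E X).
Proof.
move=> f Y Y'.
by rewrite !cov_endo.unlock !(connDr, connZr, endoD lE, endoZ lE); vring.
Qed.

End CovEndo.

(** The difference of two Levi-Civita connections is symmetric by the absence
    of torsion and skew by metricity, and a trilinear form symmetric in the
    first two and skew in the last two arguments vanishes. *)
Lemma levi_civita_unique (gg : VF -> VF -> C) n1 n2 :
  riemannian gg -> levi_civita gg n1 -> levi_civita gg n2 -> n1 = n2.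
Proof.
move=> [[gl gs] gpos] [_ t1 c1] [_ t2 c2].
pose D X Y := n1 X Y - n2 X Y.
have DC X Y : D X Y = D Y X.
  rewrite /D; have := t1 X Y; rewrite -t2 => e.
  by vpointwise.
have Dsk X Y Z : gg (D X Y) Z = - gg (D X Z) Y.
  rewrite /D ![gg (_ - _) _]gs !(one_formD (gl _)) !(one_formN (gl _)).
  have := c1 X Y Z; rewrite c2 (gs (n1 X Y)) (gs (n2 X Y)); pointwise.
have D0 X Y Z : gg (D X Y) Z = 0.
  have := Dsk X Y Z; have := Dsk Y X Z; have := Dsk Z X Y.
  rewrite (DC Y X) (DC Z X) (DC Z Y); pointwise.
apply/funext => X; apply/funext => Y; apply/eqP; rewrite -subr_eq0; apply/eqP.
apply: vf_ext => f; apply: smoothFun_ext => p.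
have [e|/gpos] := eqVneq (vf_at (D X Y) p) 0; last by rewrite D0 ltxx.
by rewrite -[LHS]/(vf_at (D X Y) p f) e.
Qed.

End Tensors.

(** * Algebra of a paracontact metric structure *)

Section Paracontact.
Context {R : realType} {n : nat} {M : manifold R n.*2.+1}.
Local Notation C := (smoothFun M).
Local Notation VF := (vectorField M).
Local Notation cst := (constS M).
Context (phi : VF -> VF) (xi : VF) (eta : VF -> C) (g : VF -> VF -> C).
Hypothesis PM : paracontact_metric phi xi eta g.
(* h is a variable, not a notation for h_tensor, so that rewriting never looks
   inside its definition. *)
Context (h : VF -> VF).
Hypothesis hE : forall X, h X = h_tensor xi phi X.
Implicit Types (f u v : C) (X Y Z W : VF) (c : R).

Let phi_endo : endo_tensor phi. Proof. by case: PM => [[]]. Qed.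
Let eta_form : one_form eta. Proof. by case: PM => [[]]. Qed.
Let phi0 := endo0 phi_endo.
Let phiN := endoN phi_endo.
Let phiD := endoD phi_endo.
Let phiZ := endoZ phi_endo.
Let eta0 := one_form0 eta_form.
Let etaN := one_formN eta_form.
Let etaD := one_formD eta_form.
Let etaZ := one_formZ eta_form.

Let g_form X : one_form (g X). Proof. by case: PM => _ [[]]. Qed.
Lemma gC X Y : g X Y = g Y X. Proof. by case: PM => _ [[]]. Qed.
Lemma gr0 X : g X 0 = 0. Proof. exact: one_form0. Qed.
Lemma grN X Y : g X (- Y) = - g X Y. Proof. exact: one_formN. Qed.
Lemma grD X Y Z : g X (Y + Z) = g X Y + g X Z. Proof. exact: one_formD. Qed.
Lemma grZ f X Y : g X (f *: Y) = f * g X Y. Proof. exact: one_formZ. Qed.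
Lemma gl0 X : g 0 X = 0. Proof. by rewrite gC gr0. Qed.
Lemma glN X Y : g (- X) Y = - g X Y. Proof. by rewrite gC grN gC. Qed.
Lemma glD X Y Z : g (X + Y) Z = g X Z + g Y Z.
Proof. by rewrite gC grD gC [g Z Y]gC. Qed.
Lemma glZ f X Y : g (f *: X) Y = f * g X Y.
Proof. by rewrite gC grZ gC. Qed.

Lemma phi2 X : phi (phi X) = X - eta X *: xi. Proof. by case: PM => [[]]. Qed.
Lemma eta_xi : eta xi = 1. Proof. by case: PM => [[]]. Qed.

Lemma g_inj X Y : (forall Z, g X Z = g Y Z) -> X = Y.
Proof.
case: PM => _ [_ gnd] _ _ XY; apply/eqP; rewrite -subr_eq0; apply/eqP.
apply: vf_ext => f; apply: smoothFun_ext => p.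
have e0 Z : g (X - Y) Z p = 0 by rewrite glD glN XY subrr.
by rewrite -[LHS]/(vf_at (X - Y) p f) (gnd p _ e0).
Qed.

(** Since phi^2 fixes ker eta and kills xi, commuting phi^2 with phi gives
    phi xi = c xi where c = eta (phi xi); then phi^2 xi = c^2 xi = 0. *)
Lemma phi_xi : phi xi = 0.
Proof.
have e X : eta X *: phi xi = eta (phi X) *: xi.
  by have := phi2 (phi X); rewrite (phi2 X) phiD phiN phiZ => /addrI /oppr_inj.
have e1 : phi xi = eta (phi xi) *: xi by rewrite -e eta_xi scale1r.
suff e2 : eta (phi xi) = 0 by rewrite e1 e2 scale0r.
apply: sqr_eq0; rewrite -[_ * _]mulr1 -eta_xi -etaZ -scalerA -e1 -phiZ -e1.
by rewrite phi2 eta_xi scale1r subrr eta0.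
Qed.

Lemma eta_phi X : eta (phi X) = 0.
Proof.
have := phi2 (phi X); rewrite (phi2 X) phiD phiN phiZ phi_xi scaler0 subr0.
move/esym/(canRL (subrK _)); rewrite -[LHS]addr0 => /addrI/esym e.
by rewrite -[LHS]mulr1 -eta_xi -etaZ e eta0.
Qed.

Lemma phi3 X : phi (phi (phi X)) = phi X.
Proof. by rewrite phi2 eta_phi scale0r subr0. Qed.

Lemma g_xi X : g X xi = eta X.
Proof.
have [_ _ gphi _] := PM; have := gphi X xi.
by rewrite phi_xi gr0 eta_xi mulr1 addrC => /esym/eqP; rewrite subr_eq0 => /eqP.
Qed.

Lemma g_xil X : g xi X = eta X.
Proof. by rewrite gC g_xi. Qed.

Lemma g_phi X Y : g (phi X) Y = - g X (phi Y).
Proof.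
have [_ _ gphi _] := PM; have := gphi X (phi Y).
by rewrite phi2 grD grN grZ g_xi !eta_phi !mulr0 subr0 addr0.
Qed.

Lemma dphiE X Y : ext_d eta X Y = g X (phi Y). Proof. by case: PM. Qed.

Lemma eta_lie X Y : eta (lie X Y) = X (eta Y) - Y (eta X) - 2 * g X (phi Y).
Proof. by rewrite -dphiE /ext_d mulrA (mulrC 2) cst2V mul1r; ring. Qed.

Lemma eta_lie_xi X : eta (lie xi X) = xi (eta X).
Proof. by rewrite eta_lie eta_xi vf1 gC g_xi eta_phi mulr0 !subr0. Qed.

Lemma h_endo : endo_tensor h.
Proof. by move=> f X Y; rewrite !hE; exact: h_tensor_endo. Qed.

Lemma two_h X : 2 *: h X = lie xi (phi X) - phi (lie xi X).
Proof. by rewrite hE /h_tensor scalerA mulrC cst2V scale1r. Qed.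

Lemma vtwo_inj X Y : 2 *: X = 2 *: Y -> X = Y :> VF.
Proof.
by move=> e; rewrite -[X]scale1r -[Y]scale1r -cst2V -!scalerA e.
Qed.

Lemma h_xi : h xi = 0.
Proof.
apply: vtwo_inj; rewrite two_h phi_xi.
have -> : lie xi xi = 0 by vring.
by rewrite phi0; vring.
Qed.

Lemma h_phi X : h (phi X) = - phi (h X).
Proof.
apply: vtwo_inj; rewrite scalerN -phiZ !two_h.
rewrite !(phiD, phiN, phi2, lieDr, lieNr, lieZr) eta_lie_xi.
by vring.
Qed.

Let linE := (phi0, phiN, phiD, phiZ, eta0, etaN, etaD, etaZ,
  gr0, grN, grD, grZ, gl0, glN, glD, glZ, eta_phi, eta_xi, phi_xi, g_xi, g_xil).

(** The sections of D+ (t = true) and of D- (t = false): eta X = 0 follows, as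
    eta vanishes on the image of phi. *)
Definition eig (t : bool) X := phi X = if t then X else - X.

Lemma eig_eta t X : eig t X -> eta X = 0.
Proof.
move=> /(congr1 eta); rewrite eta_phi; case: t => // /esym.
by rewrite etaN => e; rewrite -[LHS]opprK e oppr0.
Qed.

Lemma eigN t X : eig (~~ t) X -> phi X = if t then - X else X.
Proof. by case: t. Qed.

Lemma eig_h t X : eig t X -> eig (~~ t) (h X).
Proof.
rewrite /eig => /(congr1 h); rewrite h_phi => /(congr1 -%R).
rewrite opprK => ->.
by case: t; rewrite /= ?(endoN h_endo) ?opprK.
Qed.

(** Tensor identities need only be checked on xi, D+ and D-.  The proof avoids
    dividing by two: 2 phi^2 X is a sum of sections of D+ and D-. *)
Lemma form_split (w : VF -> C) : one_form w -> w xi = 0 ->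
  (forall t X, eig t X -> w X = 0) -> forall X, w X = 0.
Proof.
move=> lw wxi weig X.
have e1 : w (phi (phi X) + phi X) = 0.
  by apply: (weig true); rewrite /eig phiD phi3 addrC.
have e2 : w (phi (phi X) - phi X) = 0.
  by apply: (weig false); rewrite /eig phiD phiN phi3 opprB.
have -> : X = phi (phi X) + eta X *: xi by rewrite phi2 subrK.
rewrite (one_formD lw) (one_formZ lw) wxi mulr0 addr0.
by move: e1 e2; rewrite !(one_formD lw) (one_formN lw); pointwise.
Qed.

Lemma eigP t X : eig t X <->
  (if t then eigen_dist_plus phi eta else eigen_dist_minus phi eta) X.
Proof.
split=> [eX|]; last by case: (t) => -[].
by have := eig_eta eX; case: t eX => eX e0; split.
Qed.

Lemma eig_rank t p : rank_at (eig t) p n.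
Proof.
have [[_ _ _ _ /(_ p)[rp rm]] _ _ _] := PM.
have -> : eig t =
    if t then eigen_dist_plus phi eta else eigen_dist_minus phi eta.
  apply/funext => X; apply/propext; rewrite eigP.
  by case: (t).
by case: t.
Qed.

Lemma eig_nonzero t p : (0 < n)%N -> exists2 X, eig t X & vf_at X p != 0.
Proof.
move=> n0; have [e [eL efree _]] := eig_rank t p.
exists (e (Ordinal n0)); first exact: eL.
apply/eqP => e0; have := efree (fun i => (i == Ordinal n0)%:R).
move=> /(_ _ (Ordinal n0)); rewrite eqxx => h1.
suff : (1 : R) = 0 by move/eqP; rewrite oner_eq0.
apply: h1; rewrite big1 // => i _; case: eqVneq => [->|_].
  by rewrite e0 scaler0.
by rewrite scale0r.
Qed.

Lemma eig_sum t (I : finType) (c : I -> R) (X : I -> VF) :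
  (forall i, eig t (X i)) -> eig t (\sum_i cst (c i) *: X i).
Proof.
move=> eX; apply: (big_ind (eig t)).
- by rewrite /eig phi0; case: (t); rewrite ?oppr0.
- move=> U V; rewrite /eig phiD => -> ->.
  by case: (t) => //; rewrite opprD.
move=> i _; rewrite /eig phiZ (eX i : phi (X i) = _).
by case: (t) => //; rewrite scalerN.
Qed.

Lemma eig_isotropic t X Y : eig t X -> eig t Y -> g X Y = 0.
Proof.
move=> eX eY; have := g_phi X Y.
rewrite (eX : phi X = _) (eY : phi Y = _).
by case: (t); rewrite ?linE; pointwise.
Qed.

(** On an eigenvector of phi, the definition of h expresses the component of
    [xi, X] in the opposite eigendistribution through h X, and only this
    component pairs nontrivially with X. *)
Lemma pang_invariant_eig t X : eig t X ->
  pang_invariant xi eta X X = 2 * g X (h X).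
Proof.
move=> eX; have := congr1 (g^~ X) (two_h X).
rewrite /pang_invariant cst2 dphiE (eX : phi X = _) !linE g_phi.
rewrite (eX : phi X = _).
by have := gC (h X) X; case: (t) => /=; rewrite ?(lieNr, linE); pointwise.
Qed.

(** * The Levi-Civita connection of a paracontact metric *)

Section LeviCivita.
Context (nabla : VF -> VF -> VF) (LC : levi_civita g nabla).

Let conn : connection nabla. Proof. by case: LC. Qed.
Local Notation Dphi := (cov_endo nabla phi).
Local Notation Dh := (cov_endo nabla h).
Local Notation F X Y Z := (g (Dphi X Y) Z).
Let hlin := (endo0 h_endo, endoN h_endo, endoD h_endo, endoZ h_endo).

Lemma torsion X Y : lie X Y = nabla X Y - nabla Y X.
Proof. by case: LC. Qed.

Lemma compat X Y Z : X (g Y Z) = g (nabla X Y) Z + g Y (nabla X Z).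
Proof. by case: LC. Qed.

Lemma der_eta X Y : X (eta Y) = eta (nabla X Y) + g Y (nabla X xi).
Proof. by rewrite -g_xi compat g_xi. Qed.

Lemma eta_nabla_xi X : eta (nabla X xi) = 0.
Proof.
have := der_eta X xi; rewrite eta_xi vf1 gC g_xi => e.
by apply: two_inj; rewrite mulr0 e; ring.
Qed.

Lemma nabla_xi_xi : nabla xi xi = 0.
Proof.
apply: g_inj => Z; rewrite gl0 gC.
have := eta_lie_xi Z; rewrite torsion etaD etaN eta_nabla_xi der_eta.
by move=> e; apply: (addrI (eta (nabla xi Z))); rewrite -e; ring.
Qed.

Lemma nabla_xi_skew X Y :
  g (nabla X xi) Y - g (nabla Y xi) X = 2 * g X (phi Y).
Proof.
have := eta_lie X Y; rewrite torsion etaD etaN !der_eta.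
rewrite [g Y _]gC [g X (nabla _ _)]gC => e.
apply: (addIr (eta (nabla X Y) - eta (nabla Y X))); rewrite [in RHS]e.
ring.
Qed.

Lemma Dphi_skew X Y Z : F X Y Z = - F X Z Y.
Proof.
have := congr1 (X : C -> C) (g_phi Y Z); rewrite vfN !compat => e.
rewrite !cov_endo.unlock !(linE, g_phi).
have := gC (nabla X (phi Z)) Y; have := gC (nabla X Z) (phi Y).
by pointwise.
Qed.

(** This is d (d eta) = 0 written with the torsion-free connection. *)
Lemma Dphi_cyclic X Y Z : F X Y Z + F Y Z X + F Z X Y = 0.
Proof.
have := ext_d_closed Y X Z eta_form; rewrite !dphiE !compat !torsion !linE.
rewrite !cov_endo.unlock !(linE, g_phi) => e.
have := gC (nabla X (phi Y)) Z; have := gC (nabla Y (phi Z)) X.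
have := gC (nabla Z (phi X)) Y.
by pointwise.
Qed.

Lemma Dphi_xi_g X Y :
  F xi X Y = g (nabla X xi) (phi Y) - g (nabla Y xi) (phi X).
Proof.
have := Dphi_cyclic xi X Y; rewrite (Dphi_skew X) !cov_endo.unlock phi_xi.
by rewrite !(conn0r conn, linE) !g_phi; pointwise.
Qed.

(** The cyclic identity at xi expresses nabla_xi phi through nabla xi, which
    leaves nabla xi as the only unknown in the Lie derivative of phi. *)
Lemma h_nabla_xi X : h X = - nabla (phi X) xi - phi (phi X).
Proof.
apply: vtwo_inj; apply: g_inj => Z; rewrite two_h !torsion !linE.
have := Dphi_xi_g X Z; rewrite !cov_endo.unlock !linE.
have := nabla_xi_skew (phi X) Z; have := g_phi (nabla X xi) Z.
have := g_phi (phi X) Z; have := gC (phi (phi X)) Z.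
by pointwise.
Qed.

Lemma eta_h X : eta (h X) = 0.
Proof. by rewrite h_nabla_xi !linE eta_nabla_xi; ring. Qed.

Lemma phi2_h X : phi (phi (h X)) = h X.
Proof. by rewrite phi2 eta_h scale0r subr0. Qed.

Lemma nabla_xiE X : nabla X xi = phi (h X) - phi X.
Proof.
have := h_nabla_xi (phi X); rewrite phi3 h_phi phi2.
rewrite !(connDl conn, connNl conn, connZl conn) nabla_xi_xi => e.
have -> : phi (h X) = nabla X xi + phi X by rewrite -[LHS]opprK e; vring.
by vring.
Qed.

Lemma h_sym X Y : g (h X) Y = g X (h Y).
Proof.
have := nabla_xi_skew X (phi Y); rewrite !nabla_xiE !h_phi !linE.
rewrite !g_phi !phi2 !(linE, eta_h).
by have := gC (h Y) X; have := gC Y X; pointwise.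
Qed.

Lemma Dphi_xi_l X : Dphi xi X = 0.
Proof.
apply: g_inj => Z; have := Dphi_xi_g X Z; rewrite !nabla_xiE !linE => ->.
rewrite !g_phi !phi2 !linE; have := h_sym X Z; have := gC X (h Z).
have := gC X Z.
by rewrite !eta_h; pointwise.
Qed.

(** Since nabla xi = phi h - phi, the curvature applied to xi is the skew part
    of the covariant derivative of the tensor phi h - phi. *)
Lemma curvature_xi X Y : curvature nabla X Y xi =
  (Dphi X (h Y) + phi (Dh X Y) - Dphi X Y) -
  (Dphi Y (h X) + phi (Dh Y X) - Dphi Y X).
Proof.
rewrite /curvature !nabla_xiE torsion !cov_endo.unlock.
rewrite !(connDr conn, connNr conn, linE, hlin); vring.
Qed.

Lemma Dphi_xi_r X : Dphi X xi = phi (phi X) - h X.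
Proof.
by rewrite cov_endo.unlock phi_xi nabla_xiE !(conn0r conn, linE) phi2_h; vring.
Qed.

Lemma Dh_xi_r X : Dh X xi = phi (h (h X)) - phi (h X).
Proof.
rewrite cov_endo.unlock h_xi nabla_xiE !(conn0r conn, hlin, h_phi).
by vring.
Qed.

Lemma eta_Dh_xi X : eta (Dh xi X) = 0.
Proof.
have := der_eta xi (h X); rewrite nabla_xi_xi eta_h vf0 gr0 addr0 => e.
by rewrite cov_endo.unlock !linE eta_h -e subrr.
Qed.

Lemma Dh_xi_phi X : Dh xi (phi X) = - phi (Dh xi X).
Proof.
have e Y : nabla xi (phi Y) = phi (nabla xi Y).
  have /eqP := Dphi_xi_l Y; rewrite cov_endo.unlock subr_eq0.
  by move/eqP.
rewrite cov_endo.unlock e !h_phi (connNr conn) e !linE; vring.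
Qed.

(** * The nullity condition and the derivatives of phi and h *)

Section KappaMu.
Context (k mu : R).
Hypothesis KM : forall X Y, curvature nabla X Y xi =
  cst k *: (eta Y *: X - eta X *: Y) + cst mu *: (eta Y *: h X - eta X *: h Y).
Local Notation b := (cst (1 + k)).

Lemma phi_Dh_xi_h2 X :
  phi (Dh xi X) = h (h X) - b *: phi (phi X) - cst mu *: h X.
Proof.
have := KM X xi; rewrite curvature_xi !Dphi_xi_l h_xi eta_xi.
rewrite Dphi_xi_r Dh_xi_r !(linE, phi2_h, endo0 (cov_endo_r conn phi_endo X)).
rewrite cstD cst1 scaler0 scale1r -phi2 => e.
apply: oppr_inj; apply: (addrI (h (h X) - h X - (phi (phi X) - h X))).
by move: e; rewrite !(add0r, subr0, addr0) => ->; vring.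
Qed.

(** In the nullity condition at (X, xi), the terms phi (nabla_xi h) and mu h
    anticommute with phi whereas h^2 and phi^2 commute with it; so the two
    types of terms agree separately. *)
Lemma h2 X : h (h X) = b *: phi (phi X).
Proof.
have := phi_Dh_xi_h2 (phi X); rewrite Dh_xi_phi phiN phi_Dh_xi_h2.
rewrite !(linE, h_phi, hlin, phi2_h, phi3) => e.
have e2 : phi (h (h X)) = b *: phi X.
  by vpointwise.
by rewrite -phi2_h e2 phiZ.
Qed.

Lemma Dh_xi_l X : Dh xi X = - (cst mu *: phi (h X)).
Proof.
have := congr1 phi (phi_Dh_xi_h2 X); rewrite h2 phi2 eta_Dh_xi scale0r subr0.
by move=> ->; rewrite !linE phi3; vring.
Qed.

Hypothesis k1 : 1 + k != 0.

Lemma b_inj u v : b * u = b * v -> u = v.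
Proof.
move=> e; have bK : cst (1 + k)^-1 * b = 1 by rewrite -cstM mulVf ?cst1.
by rewrite -[u]mul1r -[v]mul1r -bK -!mulrA e.
Qed.

Lemma eig_h2 t X : eig t X -> h (h X) = b *: X.
Proof. by move=> /eig_eta e; rewrite h2 phi2 e scale0r subr0. Qed.

Lemma Dphi_phi X Y : Dphi X (phi Y) =
  - phi (Dphi X Y) - g Y (nabla X xi) *: xi - eta Y *: nabla X xi.
Proof.
rewrite !cov_endo.unlock !linE !phi2.
rewrite !(connDr conn, connNr conn, connZr conn) der_eta.
by vring.
Qed.

Lemma Dh_phi X Y :
  Dh X (phi Y) = - Dphi X (h Y) - phi (Dh X Y) - h (Dphi X Y).
Proof.
rewrite !cov_endo.unlock !(linE, hlin) !h_phi.
by rewrite (connNr conn); vring.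
Qed.

Lemma Dh_h X Y : Dh X (h Y) = - h (Dh X Y)
  - b *: (g Y (nabla X xi) *: xi + eta Y *: nabla X xi).
Proof.
rewrite !cov_endo.unlock !(linE, hlin) !h2 !phi2.
rewrite !(connDr conn, connNr conn, connZr conn) der_eta vf_cst.
by vring.
Qed.

Lemma Dh_sym X Y Z : g (Dh X Y) Z = g Y (Dh X Z).
Proof.
have := congr1 (X : C -> C) (h_sym Y Z); rewrite !compat !cov_endo.unlock !linE.
by have := h_sym (nabla X Y) Z; have := h_sym Y (nabla X Z); pointwise.
Qed.

(** On ker eta the right-hand side of the nullity condition vanishes. *)
Lemma codazzi X Y Z : eta X = 0 -> eta Y = 0 ->
  g (Dphi X (h Y)) Z - g (Dh X Y) (phi Z) - g (Dphi X Y) Z =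
  g (Dphi Y (h X)) Z - g (Dh Y X) (phi Z) - g (Dphi Y X) Z.
Proof.
move=> eX eY; have := congr1 (g ^~ Z) (KM X Y).
rewrite curvature_xi eX eY !linE !g_phi.
by pointwise.
Qed.

(** Because phi^2 is the identity on ker eta, nabla_X phi anticommutes with phi
    there, so it maps D+ to D-, up to multiples of xi; the orthogonal of D- in
    ker eta is D-. *)
Lemma Dphi_mixed t X Y Z : eig t Y -> eig (~~ t) Z -> F X Y Z = 0.
Proof.
move=> eY eZ; have := congr1 (g^~ Z) (Dphi_phi X Y).
rewrite !linE g_phi (eig_eta eY) (eig_eta eZ) eY (eigN eZ).
have lD := cov_endo_r conn phi_endo X.
by case: (t) => /=; rewrite ?(endoN lD) ?linE; pointwise.
Qed.

Lemma Dphi_mixed_l t X Y Z :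
  eig t Y -> eig t Z -> eig (~~ t) X -> F X Y Z = 0.
Proof.
move=> eY eZ eX; have := Dphi_cyclic X Y Z; have := Dphi_mixed Y eZ eX.
have := Dphi_mixed Z (t := ~~ t) (Y := X) (Z := Y).
rewrite negbK => /(_ eX eY); pointwise.
Qed.

(** The decisive step, which says that D+ and D- are integrable.
    Differentiating h phi = - phi h relates F U V W to the component of
    nabla_U h on V and h W, and the Codazzi identity makes the latter symmetric
    in U and V. *)
Lemma Dphi_eig_sym t X Y W :
  eig t X -> eig t Y -> eig t W -> F X Y W = F Y X W.
Proof.
move=> eX eY eW; apply: b_inj.
suff e U V : eig t U -> eig t V -> b * F U V W =
    (if t then - 2 else 2) * g (Dh U V) (h W).
  have := codazzi (h W) (eig_eta eX) (eig_eta eY).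
  have ehW := eig_h eW; rewrite (eigN ehW) !e //.
  have nX : eig (~~ ~~ t) X by rewrite negbK.
  have nY : eig (~~ ~~ t) Y by rewrite negbK.
  have := Dphi_mixed X eY ehW; have := Dphi_mixed Y eX ehW.
  have := Dphi_mixed_l (eig_h eY) ehW nX.
  have := Dphi_mixed_l (eig_h eX) ehW nY.
  case: (t) => /=; rewrite ?linE; pointwise.
move=> eU eV; have := congr1 (g^~ (h W)) (Dh_phi U V).
have nU : eig (~~ ~~ t) U by rewrite negbK.
have ehW := eig_h eW; have := Dphi_mixed_l (eig_h eV) ehW nU.
rewrite !linE g_phi h_sym (eig_h2 eW) linE (eigN ehW) eV.
have lD := cov_endo_r conn h_endo U.
case: (t) => /=; rewrite ?(endoN lD) ?linE; pointwise.
Qed.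

(** Skew in the last two and symmetric in the first two arguments. *)
Lemma Dphi_eig t X Y Z : eig t X -> eig t Y -> eig t Z -> F X Y Z = 0.
Proof.
move=> eX eY eZ.
have := Dphi_eig_sym eX eY eZ; have := Dphi_skew Y X Z.
have := Dphi_eig_sym eY eZ eX; have := Dphi_skew Z Y X.
have := Dphi_eig_sym eZ eX eY; have := Dphi_skew X Z Y.
by pointwise.
Qed.

Lemma DphiE X Y :
  Dphi X Y = eta Y *: (X - h X) - g (X - h X) Y *: xi.
Proof.
(* w is the component along Z of the difference of the two sides. *)
pose w X Y Z := F X Y Z - eta Y * g (X - h X) Z + g (X - h X) Y * eta Z.
suff e : w X Y =1 fun=> 0.
  by apply: g_inj => Z; have := e Z; rewrite /w !linE; pointwise.
move=> Z; have lDr := cov_endo_r conn phi_endo.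
have lDl := cov_endo_l conn phi_endo.
have w_xi2 X' Z' : w X' xi Z' = 0.
  by rewrite /w Dphi_xi_r !linE phi2 !linE eta_h; ring.
have w_skew X' Y' Z' : w X' Y' Z' = - w X' Z' Y' by rewrite /w Dphi_skew; ring.
move: X; apply: form_split.
- move=> f X X'; rewrite /w lDl !(linE, hlin); ring.
- rewrite /w Dphi_xi_l h_xi subr0 !linE; ring.
move=> t1 X eX; move: Y; apply: form_split => //.
- move=> f Y Y'; rewrite /w lDr !linE; ring.
move=> t2 Y eY; move: Z; apply: form_split; last 1 first.
- move=> t3 Z eZ; rewrite /w (eig_eta eY) (eig_eta eZ) mul0r mulr0 subr0 addr0.
  have [e23|n23] := eqVneq t2 t3; last first.
    by apply: (Dphi_mixed _ eY); rewrite (neq_negb n23).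
  subst t3; have [e12|n12] := eqVneq t1 t2.
    by subst t2; exact: (Dphi_eig eX).
  apply: (Dphi_mixed_l eY eZ).
  by rewrite eq_sym in n12; rewrite (neq_negb n12).
- by move=> f Z Z'; rewrite /w !linE; ring.
- by rewrite w_skew w_xi2 oppr0.
Qed.

(** Now that nabla phi has no component along ker eta, the Codazzi identity
    involves nabla h only. *)
Lemma codazzi_eig t X Y Z : eta X = 0 -> eta Y = 0 -> eig t Z ->
  g (Dh X Y) Z = g (Dh Y X) Z.
Proof.
move=> eX eY eZ; have := codazzi Z eX eY.
rewrite !DphiE eX eY !eta_h !linE (eig_eta eZ) eZ.
by case: (t); rewrite ?linE; pointwise.
Qed.

Lemma Dh_mixed t X Y Z : eta X = 0 -> eig t Y -> eig (~~ t) Z ->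
  g (Dh X Y) Z = 0.
Proof.
move=> eX eY eZ; have := congr1 (g^~ Z) (Dh_phi X Y).
rewrite !DphiE !(linE, hlin, h_xi, eta_h) g_phi (eig_eta eY) (eig_eta eZ).
rewrite eY (eigN eZ); have lD := cov_endo_r conn h_endo X.
by case: (t) => /=; rewrite ?(endoN lD) ?linE; pointwise.
Qed.

(** When two of the three arguments lie in different eigendistributions, the
    symmetries of nabla h bring them to the last two places, where Dh_mixed
    applies.  When all three lie in the same one, h^2 = 1 + k there allows
    to move h from one argument to another and to reach the previous case. *)
Lemma Dh_eig t1 t2 t3 X Y Z : eig t1 X -> eig t2 Y -> eig t3 Z ->
  g (Dh X Y) Z = 0.
Proof.
have D2 s1 s2 U V W : s1 != s2 -> eig s1 U -> eig s2 V -> eig s2 W ->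
    g (Dh U V) W = 0.
  move=> n12 eU eV eW; rewrite (codazzi_eig (eig_eta eU) (eig_eta eV) eW).
  by apply: (Dh_mixed (eig_eta eV) eU); rewrite (neq_negb n12).
move=> eX eY eZ; have [e23|n23] := eqVneq t2 t3; last first.
  by apply: (Dh_mixed (eig_eta eX) eY); rewrite (neq_negb n23).
subst t3; have [e12|n12] := eqVneq t1 t2; last exact: D2 n12 eX eY eZ.
subst t2; apply: b_inj; have lD := cov_endo_r conn h_endo X.
have := congr1 (g^~ Z) (Dh_h X (h Y)).
rewrite (eig_h2 eY) (endoZ lD) !linE h_sym (eig_eta eZ) eta_h => ->.
rewrite (D2 t1 (~~ t1)) //; try exact: eig_h; last by case: (t1).
by ring.
Qed.

Lemma DhE X Y : Dh X Y =
  eta Y *: (b *: phi X - phi (h X)) + g (b *: phi X - phi (h X)) Y *: xi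
  - (cst mu * eta X) *: phi (h Y).
Proof.
pose V X := b *: phi X - phi (h X).
pose w X Y Z := g (Dh X Y) Z - eta Y * g (V X) Z - g (V X) Y * eta Z
  + cst mu * eta X * g (phi (h Y)) Z.
suff e : w X Y =1 fun=> 0.
  by apply: g_inj => Z; have := e Z; rewrite /w /V !linE; pointwise.
move=> Z; have lDr := cov_endo_r conn h_endo.
have lDl := cov_endo_l conn h_endo.
have w_xi2 X' Z' : w X' xi Z' = 0.
  by rewrite /w /V Dh_xi_r h2 !(linE, h_xi, phi3); ring.
have w_sym X' Y' Z' : w X' Y' Z' = w X' Z' Y'.
  have e : g (phi (h Y')) Z' = g (phi (h Z')) Y'.
    by rewrite g_phi h_sym h_phi grN opprK gC.
  by rewrite /w Dh_sym e gC; ring.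
move: X; apply: form_split.
- move=> f X X'; rewrite /w /V lDl !(linE, hlin); ring.
- by rewrite /w /V Dh_xi_l h_xi !linE; ring.
move=> t1 X eX; move: Y; apply: form_split => //.
- move=> f Y Y'; rewrite /w lDr !(linE, hlin); ring.
move=> t2 Y eY; move: Z; apply: form_split; last 1 first.
- move=> t3 Z eZ; rewrite /w (Dh_eig eX eY eZ).
  by rewrite (eig_eta eX) (eig_eta eY) (eig_eta eZ); ring.
- by move=> f Z Z'; rewrite /w !linE; ring.
- by rewrite w_sym w_xi2.
Qed.

(** * The associated contact metric structure *)

Section AssociatedContact.
Context (a : R).
Hypothesis a2b : a * a * (1 + k) = 1.
Local Notation al := (cst a).
Local Notation m2 := (cst (mu / 2)).

Let al2b : al * al * b = 1. Proof. by rewrite -!cstM a2b cst1. Qed.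
Let mu2 : cst mu = 2 * m2.
Proof.
by rewrite cstM mulrCA -[2]cst2 -cstM divff ?cst1 ?mulr1 // pnatr_eq0.
Qed.

Lemma phih_sym X Y : g X (phi (h Y)) = g Y (phi (h X)).
Proof. by rewrite gC g_phi h_sym h_phi grN opprK. Qed.

Definition assoc_phi X := - al *: phi (h X).
Definition assoc_g X Y := al * g X (h Y) + eta X * eta Y.
(** The solution of Koszul's formula for the difference of the two Levi-Civita
    connections.  It is explicit because the derivative of the new metric is,
    by DhE and nabla_xiE, and because the operator a h + eta (x) xi that relates
    the two metrics is an involution. *)
Definition assoc_diff X Y :=
  (al - 1) *: (eta Y *: phi (h X) + eta X *: phi (h Y))
  + m2 *: (eta X *: phi Y + eta Y *: phi X)
  + ((1 - al + al * m2) * g X (phi (h Y))) *: xi.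
Definition assoc_nabla X Y := nabla X Y + assoc_diff X Y.

Lemma assoc_diffC X Y : assoc_diff X Y = assoc_diff Y X.
Proof. by rewrite /assoc_diff phih_sym; vring. Qed.

Lemma nablaE (E : VF -> VF) X Y :
  nabla X (E Y) = cov_endo nabla E X Y + E (nabla X Y).
Proof. by rewrite cov_endo.unlock subrK. Qed.

(* Moves every operator to the second argument of g and reduces words in phi and
   h, so that only the symmetry of g remains to be supplied to ring. *)
Let reduce := (linE, hlin, g_phi, h_sym, h_phi, h_xi, eta_h, phi2_h, phi3, h2).

Lemma assoc_levi_civita : levi_civita assoc_g assoc_nabla.
Proof.
split.
- split=> [f X X' Y|X Y Z|f X Y]; rewrite /assoc_nabla /assoc_diff.
  + by rewrite (connDl conn) (connZl conn) !(linE, hlin); vring.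
  + by rewrite (connDr conn) !(linE, hlin); vring.
  + by rewrite (connZr conn) !(linE, hlin); vring.
- by move=> X Y; rewrite /assoc_nabla assoc_diffC torsion; vring.
move=> X Y Z; rewrite /assoc_nabla /assoc_g !(derE, compat) !der_eta.
rewrite (nablaE h) DhE !nabla_xiE /assoc_diff mu2.
rewrite !reduce ?phi2 ?(linE, hlin).
have e1 := phih_sym Y X; have e2 := phih_sym Z X.
have e3 : g Y (phi X) = - g X (phi Y) by rewrite gC g_phi.
have e4 : g Z (phi X) = - g X (phi Z) by rewrite gC g_phi.
have e5 := phih_sym Z Y.
have e6 : g Z (phi Y) = - g Y (phi Z) by rewrite gC g_phi.
ring: e1 e2 e3 e4 e5 e6 al2b.
Qed.

Lemma assoc_nabla_xi X : assoc_nabla X xi = (m2 - 1) *: phi X + al *: phi (h X).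
Proof.
by rewrite /assoc_nabla /assoc_diff nabla_xiE !(linE, hlin, h_xi); vring.
Qed.

(** The derivative of xi is a combination of phi and phi h, so its covariant
    derivative is known from DphiE and DhE; skew-symmetrizing in X and Y removes
    the components along xi that these formulas carry. *)
Lemma assoc_curvature_xi X Y : curvature assoc_nabla X Y xi =
  (1 - (m2 - 1) * (m2 - 1)) *: (eta Y *: X - eta X *: Y)
  + (2 * (m2 - 1) * (al - 1)) *: (eta Y *: h X - eta X *: h Y).
Proof.
rewrite /curvature !assoc_nabla_xi torsion /assoc_nabla.
rewrite !(connDr conn, connZr conn) !(nablaE phi) !(nablaE h) !DphiE !DhE.
rewrite /assoc_diff mu2 !reduce ?phi2 ?(linE, hlin).
have e1 := phih_sym Y X.
have e3 : g Y (phi X) = - g X (phi Y) by rewrite gC g_phi.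
have e4 := gC Y X.
have e5 : g Y (h X) = g X (h Y) by rewrite gC h_sym.
apply: vf_ext => f; rewrite ?(appE, derE).
ring: e1 e3 e4 e5 al2b.
Qed.

(** In the Lie derivative of phi h along xi the h^2 terms, which come from the
    derivatives of xi along phi h X and along X, cancel; the rest is 2 h plus
    phi (nabla_xi h) = - mu h. *)
Lemma assoc_h X : h_tensor xi assoc_phi X = (al * (m2 - 1)) *: h X.
Proof.
apply: vtwo_inj; rewrite /h_tensor scalerA mulrC cst2V scale1r /lie_endo.
rewrite /assoc_phi lieZr !torsion (nablaE phi) (nablaE h) Dphi_xi_l Dh_xi_l.
rewrite !nabla_xiE !reduce !mu2 ?phi2 derE vf_cst.
vring.
Qed.

Hypothesis pang_pos : forall t p X, eig t X -> vf_at X p != 0 ->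
  0 < (al * g X (h X)) p.
Hypothesis n_gt0 : (0 < n)%N.

(** The sign hypothesis says nothing of a section X that vanishes at p; there,
    X is perturbed by small multiples of a section of the same distribution
    that does not vanish at p. *)
Lemma eig_ge0 t p X : eig t X -> 0 <= (al * g X (h X)) p.
Proof.
move=> eX; have [Y eY Y0] := eig_nonzero t p n_gt0.
have [X0|] := eqVneq (vf_at X p) 0; last by move=> /(pang_pos eX)/ltW.
apply: (@quadratic_ge0 _ _ ((al * (2 * g X (h Y))) p) ((al * g Y (h Y)) p)).
  exact: pang_pos eY Y0.
move=> c c0; have eZ : eig t (X + cst c *: Y).
  rewrite /eig !linE (eX : phi X = _) (eY : phi Y = _).
  by case: (t) => //; vring.
have : vf_at (X + cst c *: Y) p != 0.
  apply/eqP => Z0; move/eqP: Y0; apply; apply: vf_at_eq0 => f.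
  have : vf_at (X + cst c *: Y) p f = 0 by rewrite Z0.
  rewrite /vf_at !appE !evE -[X f p]/(vf_at X p f) X0 add0r.
  by move/eqP; rewrite mulf_eq0 (negbTE c0) => /eqP.
move/(pang_pos eZ); rewrite !(linE, hlin).
have := h_sym X Y; rewrite (gC (h X)) => /(congr1 (fun u : C => u p)).
rewrite !evE => ->.
by congr (_ < _); ring.
Qed.

Lemma assoc_riemannian : riemannian assoc_g.
Proof.
split.
  split=> [X f Y Z|X Y]; rewrite /assoc_g ?(linE, hlin).
    by ring.
  by rewrite -(h_sym X Y) (gC (h X)); ring.
move=> p X X0.
pose P := phi (phi X) + phi X; pose Q := phi (phi X) - phi X.
have eP : eig true P by rewrite /eig /P phiD phi3 addrC.
have eQ : eig false Q by rewrite /eig /Q phiD phiN phi3 opprB.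
have eX : 2 *: X = P + Q + (2 * eta X) *: xi by rewrite /P /Q phi2; vring.
have gE : 4 * assoc_g X X =
    al * g P (h P) + al * g Q (h Q) + 4 * (eta X * eta X).
  rewrite /assoc_g /P /Q !reduce ?phi2 ?reduce; ring.
have : 0 < (4 * assoc_g X X) p.
  rewrite gE; have gP := eig_ge0 p eP; have gQ := eig_ge0 p eQ.
  have [eta0'|etaX0] := eqVneq (eta X p) 0; last first.
    have : 0 < eta X p * eta X p by rewrite -expr2 exprn_even_gt0.
    by move: gP gQ; rewrite !evE; lra.
  suff : 0 < (al * g P (h P)) p \/ 0 < (al * g Q (h Q)) p.
    by move: gP gQ; rewrite !evE eta0' => ? ? []; lra.
  have [P0|] := eqVneq (vf_at P p) 0; last by move/(pang_pos eP); left.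
  have [Q0|] := eqVneq (vf_at Q p) 0; last by move/(pang_pos eQ); right.
  case/eqP: X0; apply: vf_at_eq0 => f.
  have Pf : P f p = 0 by rewrite -[LHS]/(vf_at P p f) P0.
  have Qf : Q f p = 0 by rewrite -[LHS]/(vf_at Q p f) Q0.
  have := congr1 (fun Z : VF => Z f p) eX; move: Pf Qf.
  by rewrite /P /Q !appE !evE eta0'; lra.
by rewrite !evE; lra.
Qed.

Lemma assoc_contact_metric :
  contact_form eta -> contact_metric assoc_phi xi eta assoc_g.
Proof.
move=> ce; rewrite /assoc_phi /assoc_g; split; split.
- exact: ce.
- by split=> [|X]; [exact: eta_xi | rewrite dphiE !linE].
- by move=> f X Y; rewrite !(linE, hlin); vring.
- exact: assoc_riemannian.
- move=> X; rewrite !reduce phi2; apply: vf_ext => f; rewrite !appE.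
  by ring: al2b.
- by rewrite h_xi phi0 scaler0.
- by move=> X; rewrite h_xi !linE; ring.
- by move=> X Y; rewrite !reduce ?phi2 ?linE; ring: al2b.
- by move=> X Y; rewrite dphiE !reduce ?phi2 ?linE; ring: al2b.
Qed.

(** On D+ and D- the form d eta is, up to sign, g, which pairs D+ with D-.  With
    e a frame of D+ at p, the frame a h e of D- has the Gram matrix of e for the
    new metric, which is positive definite; f corrects it by the inverse
    matrix. *)
Lemma deta_dual_frames p : exists e f : 'I_n -> VF,
  [/\ forall i, eig true (e i), forall i, eig false (f i) &
      forall i j, ext_d eta (e i) (f j) p = (i == j)%:R].
Proof.
have [e [eL efree _]] := eig_rank true p.
have [[grform gsym] gpos] := assoc_riemannian.
pose G : 'M[R]_n := \matrix_(i, j) assoc_g (e i) (e j) p.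
have Gu : G \in unitmx.
  rewrite unitmxE unitfE; apply/negP => /det0P[v v0 vG].
  pose V := \sum_i cst (v 0 i) *: e i.
  have gV : assoc_g V V p = 0.
    have Vr : assoc_g V V = \sum_j cst (v 0 j) * assoc_g V (e j).
      exact: form_sum (grform V).
    have Vl j : assoc_g V (e j) = \sum_i cst (v 0 i) * assoc_g (e i) (e j).
      rewrite gsym; apply: etrans (form_sum _ _ (grform (e j))) _.
      by apply: eq_bigr => i _; rewrite gsym.
    rewrite Vr ev_sum big1 // => j _.
    have := congr1 (fun w : 'rV_n => w 0 j) vG; rewrite !mxE => Gj.
    rewrite evM Vl ev_sum [X in _ * X](_ : _ = 0) ?mulr0 // -[RHS]Gj.
    by apply: eq_bigr => i _; rewrite mxE evM.
  have [V0|/gpos] := eqVneq (vf_at V p) 0; last by rewrite gV ltxx.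
  case/eqP: v0; apply/rowP => i; rewrite mxE.
  by apply: (efree (fun i => v 0 i)); rewrite -vf_at_sum.
pose f j := \sum_k cst (- invmx G k j) *: (al *: h (e k)).
exists e, f; split=> //.
  move=> j; apply: eig_sum => l; rewrite /eig phiZ.
  by have /= := eig_h (eL l); rewrite /eig => ->; rewrite scalerN.
move=> i j; have ef : phi (f j) = - f j.
  apply: (eig_sum (t := false)) => l; rewrite /eig phiZ.
  by have /= := eig_h (eL l); rewrite /eig => ->; rewrite scalerN.
have := congr1 (fun B : 'M_n => B i j) (mulmxV Gu); rewrite !mxE => <-.
rewrite dphiE ef grN /f form_sum; last by move=> u Y Z; rewrite !linE.
rewrite evN ev_sum -sumrN; apply: eq_bigr => l _.
rewrite grZ mxE /assoc_g (eig_eta (eL i)) !evE.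
ring.
Qed.

Lemma eta_contact_form : contact_form eta.
Proof.
split=> // p; have [e [f [eL fL ef]]] := deta_dual_frames p.
pose idx (x : 'I_n.*2.+1) : 'I_n := insubd (Ordinal n_gt0) x.-1./2.
pose X (x : 'I_n.*2.+1) :=
  if x == ord0 then xi else if odd x then e (idx x) else f (idx x).
pose o := @odd_slot n; pose r := @even_slot n.
have [oK rK] := (@val_odd_slot n, @val_even_slot n).
have [oz rz] := (@odd_slot_neq0 n, @even_slot_neq0 n).
have Xo i : X (o i) = e i.
  rewrite /X (negbTE (oz i)) oK /= odd_double /idx oK /=; congr e.
  by apply: val_inj; rewrite val_insubd /= doubleK ltn_ord.
have Xr i : X (r i) = f i.
  rewrite /X (negbTE (rz i)) rK /= odd_double /idx rK /=; congr f.
  by apply: val_inj; rewrite val_insubd /= uphalf_double ltn_ord.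
have Xz : X ord0 = xi by [].
exists X; rewrite /eta_wedge_deta evM ev_cst mulf_neq0 //.
  by rewrite invr_neq0 // pnatr_eq0 -lt0n fact_gt0.
rewrite ev_sum.
pose c x := eta (X x) p; pose A x y := ext_d eta (X x) (X y) p.
rewrite (eq_bigr (wedge_term ord0 o r c A)); last first.
  by move=> s _; rewrite !evM ev_sign ev_prod.
have [coo crr cor] : [/\ forall i j, A (o i) (o j) = 0,
    forall i j, A (r i) (r j) = 0 & forall i j, A (o i) (r j) = (i == j)%:R].
  split=> i j; rewrite /A ?Xo ?Xr // dphiE.
    by rewrite (eL j : phi _ = _) (eig_isotropic (eL i) (eL j)).
  by rewrite (fL j : phi _ = _) grN (eig_isotropic (fL i) (fL j)) oppr0.
rewrite gt_eqF //; apply: wedge_sum_gt0 => //.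
- exact: odd_slot_inj.
- exact: even_slot_inj.
- exact: odd_even_slot.
- exact: slot_cases.
- move=> x; rewrite /c; case: (slot_cases x) => [->|[i ->]|[i ->]].
  + by rewrite Xz eta_xi eqxx.
  + by rewrite Xo (eig_eta (eL i)) (negbTE (oz i)).
  + by rewrite Xr (eig_eta (fL i)) (negbTE (rz i)).
- by move=> x y; rewrite /A !dphiE -evN -g_phi gC.
- by move=> x; rewrite /A Xz dphiE !linE.
Qed.

(** The hypothesis on mu' compares the coefficient 2 (mu / 2 - 1) (a - 1) of h
    in the curvature with the coefficient a (mu / 2 - 1) of h in the tensor h of
    the new structure. *)
Lemma assoc_kappa_mu_condition mu' : mu' * a = 2 * (a - 1) ->
  kappa_mu_condition assoc_phi xi eta assoc_g (1 - (1 - mu / 2) ^+ 2) mu'.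
Proof.
move=> mu'a; exists assoc_nabla; first exact: assoc_levi_civita.
have e : 2 * (m2 - 1) * (al - 1) = cst mu' * (al * (m2 - 1)).
  have -> : cst mu' * (al * (m2 - 1)) = cst (mu' * a) * (m2 - 1).
    by rewrite (cstM mu'); ring.
  by rewrite mu'a (cstM 2) cst2 cstD cstN cst1; ring.
move=> X Y; rewrite assoc_curvature_xi !assoc_h expr2 e.
by apply: vf_ext => f; rewrite !appE !cstE; ring.
Qed.

Lemma assoc_kappa_mu mu' : mu' * a = 2 * (a - 1) ->
  contact_kappa_mu assoc_phi xi eta assoc_g (1 - (1 - mu / 2) ^+ 2) mu'.
Proof.
move=> /assoc_kappa_mu_condition; split => //.
exact: assoc_contact_metric eta_contact_form.
Qed.

Lemma assoc_sasakian : mu = 2 -> sasakian assoc_phi xi eta assoc_g.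
Proof.
move=> mu_2; split; first exact: assoc_contact_metric eta_contact_form.
exists assoc_nabla; first exact: assoc_levi_civita.
move=> X Y; rewrite assoc_curvature_xi mu_2 divff ?pnatr_eq0 // cst1 subrr.
by vring.
Qed.

(** The pairing with h X kills the h X term of the curvature, as h X lies in the
    isotropic D-, and leaves (mu / 2 - 1)^2 times the positive a g(X, h X). *)
Lemma assoc_not_sasakian : mu <> 2 -> ~ sasakian assoc_phi xi eta assoc_g.
Proof.
move=> mu2' [_ [nabla' LC' curv']].
have nablaE' := levi_civita_unique assoc_riemannian LC' assoc_levi_civita.
have [p _] := manifold_inhabited M.
have [X eX X0] := eig_nonzero true p n_gt0.
have := curv' X xi; rewrite nablaE' assoc_curvature_xi.
move=> /(congr1 (fun Z : VF => al * g Z (h X))).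
rewrite h_xi eta_xi (eig_eta eX) !linE (eig_isotropic (eig_h eX) (eig_h eX)).
move=> /(congr1 (fun u : C => u p)); rewrite !evE => e.
have := pang_pos eX X0; rewrite evE.
set q := g X (h X) p in e *; set m := mu / 2 in e *.
move=> q0; apply: mu2'; suff : m - 1 = 0 by rewrite /m => m1; lra.
apply/eqP; rewrite -[_ == 0]orbb -mulf_eq0; apply/eqP.
have : ((m - 1) * (m - 1)) * (a * q) = 0 by lra.
by move/eqP; rewrite mulf_eq0 (gt_eqF q0) orbF => /eqP.
Qed.

End AssociatedContact.
End KappaMu.
End LeviCivita.

End Paracontact.

Theorem theorem4p7 (R : realType) (n : nat) (M : manifold R n.*2.+1)
    (phit : vectorField M -> vectorField M) (xi : vectorField M)
    (eta : vectorField M -> smoothFun M)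
    (gt : vectorField M -> vectorField M -> smoothFun M)
    (kt mut : R) (pos : bool) :
  (0 < n)%N ->
  paracontact_kappa_mu phit xi eta gt kt mut ->
  -1 < kt ->
  (if pos then pang_positive_definite phit xi eta
   else pang_negative_definite phit xi eta) ->
  let eps : R := if pos then 1 else -1 in
  let phi := fun X =>
    constS M (- eps * (1 / Num.sqrt (1 + kt))) *: phit (h_tensor xi phit X) in
  let g := fun X Y => - ext_d eta X (phi Y) + eta X * eta Y in
  [/\ contact_metric phi xi eta g,
      mut = 2 -> sasakian phi xi eta g &
      mut <> 2 ->
        ~ sasakian phi xi eta g /\
        contact_kappa_mu phi xi eta g
          (1 - (1 - mut / 2) ^+ 2) (2 * (1 - eps * Num.sqrt (1 + kt)))].
Proof.
move=> n_gt0 [PM [nabla LC KM]] kt1 pang eps phi g.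
have b0 : 0 < 1 + kt by lra.
have b_neq0 : 1 + kt != 0 by rewrite gt_eqF.
have s0 : 0 < Num.sqrt (1 + kt) by rewrite sqrtr_gt0.
have ss : Num.sqrt (1 + kt) * Num.sqrt (1 + kt) = 1 + kt.
  by rewrite -expr2 sqr_sqrtr // ltW.
have eps2 : eps * eps = 1 by rewrite /eps; case: (pos); rewrite ?mulrNN mulr1.
set s := Num.sqrt (1 + kt) in s0 ss phi g *; clearbody s.
set a := eps / s.
have as_eps : a * s = eps by rewrite divfK // gt_eqF.
have a2b : a * a * (1 + kt) = 1 by rewrite -ss mulrACA as_eps eps2.
have mu'a : 2 * (1 - eps * s) * a = 2 * (a - 1).
  by rewrite -mulrA mulrBl mul1r -mulrA [s * a]mulrC as_eps eps2.
pose h := h_tensor xi phit; have hE X : h X = h_tensor xi phit X by [].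
have phiE : phi = assoc_phi phit h a.
  apply/funext => X; rewrite /phi /assoc_phi /a mul1r mulNr cstN.
  by [].
have gE : g = assoc_g eta gt h a.
  apply/funext => X; apply/funext => Y; rewrite /g phiE (dphiE PM) /assoc_phi.
  have lphi : endo_tensor phit by case: PM => [[]].
  by rewrite (endoZ lphi) (grZ PM) (phi2_h PM hE LC) mulNr opprK.
have pang_pos t p X : eig phit t X -> vf_at X p != 0 ->
    0 < (constS M a * gt X (h X)) p.
  move=> eX X0; have pE := pang_invariant_eig PM hE eX.
  have eX' := (eigP PM t X).1 eX.
  (* 2 gt X (h X) is the Pang invariant. *)
  suff : 0 < (eps * (2 * gt X (h X)) p) * (2^-1 / s).
    rewrite !evE /a mulrA => q0; apply: etrans q0; congr (_ < _).
    by field; rewrite gt_eqF.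
  rewrite mulr_gt0 //; last by rewrite divr_gt0 // invr_gt0 ltr0n.
  rewrite -pE /eps; move: pang; case: (pos) => -[pp pm].
    by rewrite mul1r; case: (t) eX' => eX'; [exact: pp | exact: pm].
  by rewrite mulN1r oppr_gt0; case: (t) eX' => eX'; [exact: pp | exact: pm].
rewrite gE phiE; split.
- apply: (assoc_contact_metric PM hE LC KM a2b pang_pos n_gt0).
  exact: (eta_contact_form PM hE LC pang_pos n_gt0).
- exact: (assoc_sasakian PM hE LC KM b_neq0 a2b pang_pos n_gt0).
move=> mu2; split.
  exact: (assoc_not_sasakian PM hE LC KM b_neq0 a2b pang_pos n_gt0).
exact: (assoc_kappa_mu PM hE LC KM b_neq0 a2b pang_pos n_gt0).
Qed.
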